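(* Let $X$ be a complete metric space, $m\geq 0$, and $(f,\pi_1,\dots,\pi_m)\in \operatorname{Lip}_b(X)\times\operatorname{Lip}(X)^m$. Define $\omega:\mathbf M_m(X)\to\mathbb R$ by $\omega(T):= T(f,\pi_1,\dots,\pi_m)$. Then $$h(x):= |f(x)|\prod_{i=1}^m\operatorname{Lip} \pi_i(x)$$ is an upper norm of $\omega$ and $$g(x):= \operatorname{Lip} f(x)\prod_{i=1}^m\operatorname{Lip} \pi_i(x)$$ is an upper gradient of $\omega$ with respect to $\mathbf M_{m+1}(X)$. (If $m=0$, the products $\prod_{i=1}^m\operatorname{Lip}\pi_i(x)$ are replaced by $1$.)
   Context: $\operatorname{Lip}(X)$, $\operatorname{Lip}_b(X)$ are the spaces of real-valued Lipschitz, resp. bounded Lipschitz functions on $X$; $\operatorname{Lip}(f)$ is the Lipschitz constant of $f$. The pointwise (upper) Lipschitz constant of a Lipschitz function $f$ at $x$ is $\operatorname{Lip} f(x)=\lim_{r\to0^+}L_rf(x)$, where $L_rf(x)=\sup_{s<r}\sup_{d(x,y)<s}\frac{|f(x)-f(y)|}{s}$. Metric currents. For $m\ge 0$, an $m$-dimensional metric current on a complete metric space $X$ (in the sense of Ambrosio–Kirchheim) is a multilinear functional $T:\operatorname{Lip}_b(X)\times\operatorname{Lip}(X)^m\to\mathbb R$ such that: (1) $T(f,\pi_1^j,\dots,\pi_m^j)\to T(f,\pi_1,\dots,\pi_m)$ whenever $\pi_i^j\to\pi_i$ pointwise as $j\to\infty$ and $\sup_{i,j}\operatorname{Lip}(\pi_i^j)<\infty$;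 (2) $T(f,\pi_1,\dots,\pi_m)=0$ whenever $\{f\neq 0\}\subset\bigcup_{i=1}^m B_i$ with $B_i$ Borel and $\pi_i$ constant on $B_i$; (3) there is a finite Borel measure $\mu$ on $X$ with $|T(f,\pi_1,\dots,\pi_m)|\le \prod_{i=1}^m\operatorname{Lip}(\pi_i)\int_X|f|\,d\mu$ for all $(f,\pi_1,\dots,\pi_m)$. The space of these is $\mathbf M_m(X)$; the minimal $\mu$ in (3) is denoted $\|T\|$. For $m\ge1$ the boundary is $\partial T(f,\pi_1,\dots,\pi_{m-1})=T(1,f,\pi_1,\dots,\pi_{m-1})$. Cochains. A cochain on an additive subgroup $\mathcal C\subset\mathbf M_m(X)$ is a function $\omega:\mathcal C\to\overline{\mathbb R}$ with $\omega(0)=0$ and $|\omega(T)|\le|\omega(T+S)|+|\omega(S)|$ for all $T,S\in\mathcal C$. A Borel function $h:X\to[0,\infty]$ is an upper norm of $\omega$ if $|\omega(T)|\le\int_X h\,d\|T\|$ for all $T\in\mathcal C$. For $\mathcal C'\subset\mathbf M_{m+1}(X)$, a Borel function $g:X\to[0,\infty]$ is an upper gradient of $\omega$ with respect to $\mathcal C'$ if $|\omega(T)|\le\int_X g\,d\|S\|$ for all $T\in\mathcal C$ and $S\in\mathcal C'$ with $\partial S=T$. *)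

(* Defs.v *)
From HB Require Import structures.
From mathcomp Require Import all_boot all_order all_algebra.
From mathcomp Require Import all_classical all_reals all_analysis.
From mathcomp Require Import measurable_realfun.
Import Order.TTheory GRing.Theory Num.Theory.
Import numFieldNormedType.Exports.

Set Implicit Arguments.
Unset Strict Implicit.
Unset Printing Implicit Defensive.

Local Open Scope classical_set_scope.
Local Open Scope ring_scope.

(* [Complete] and [measurableType] both include [isPointed], so such a space is
   nonempty. *)
#[short(type="completeMetricType")]
HB.structure Definition CompleteMetric (R : numDomainType) :=
  {T of Metric R T & Complete T}.

Definition borel (R : realType) (X : completeMetricType R) :=
  g_sigma_algebraType (@open X).

(* The library's [lipschitz] is restricted to normed modules, hence the
   definitions below over a metric space. *)
Section lipschitz_spaces.
Context {R : realType} (X : completeMetricType R).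
Implicit Types (f g : X -> R).

Definition lip_bound f (K : R) :=
  0 <= K /\ forall x y, `|f x - f y| <= K * mdist x y.

Definition is_lip f := exists K, lip_bound f K.

Definition is_bounded f := exists M, forall x, `|f x| <= M.

Definition lip_pred : {pred X -> R} := fun f => `[< is_lip f >].

Definition lipb_pred : {pred X -> R} :=
  fun f => `[< is_lip f /\ is_bounded f >].

Let is_lip0 : is_lip 0.
Proof. by exists 0; split=> // x y; rewrite subrr normr0 mul0r. Qed.

Let is_lipP (a : R) f g : is_lip f -> is_lip g -> is_lip (a *: f + g).
Proof.
move=> [K [K0 fK]] [L [L0 gL]]; exists (`|a| * K + L).
split=> [|x y]; first by rewrite addr_ge0// mulr_ge0.
have -> : (a *: f + g) x - (a *: f + g) y = a * (f x - f y) + (g x - g y).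
  by rewrite mulrBr opprD addrACA.
rewrite (le_trans (ler_normD _ _))// mulrDl lerD// normrM -mulrA.
by rewrite ler_wpM2l.
Qed.

Let is_boundedP (a : R) f g :
  is_bounded f -> is_bounded g -> is_bounded (a *: f + g).
Proof.
move=> [M fM] [N gN]; exists (`|a| * M + N) => x.
by rewrite (le_trans (ler_normD _ _))// lerD// normrM ler_wpM2l.
Qed.

Lemma lip_submod_closed : submod_closed lip_pred.
Proof.
split=> [|a f g /asboolP fL /asboolP gL]; apply/asboolP; first exact: is_lip0.
exact: is_lipP.
Qed.

Lemma lipb_submod_closed : submod_closed lipb_pred.
Proof.
split=> [|a f g /asboolP[fL fb] /asboolP[gL gb]]; apply/asboolP.
  by split; [exact: is_lip0|exists 0 => x; rewrite normr0].
by split; [exact: is_lipP|exact: is_boundedP].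
Qed.

HB.instance Definition _ :=
  GRing.isSubmodClosed.Build R (X -> R) lip_pred lip_submod_closed.
HB.instance Definition _ :=
  GRing.isSubmodClosed.Build R (X -> R) lipb_pred lipb_submod_closed.

Record Lip := MkLip { lip_fun :> X -> R; lip_funP : lip_fun \in lip_pred }.
HB.instance Definition _ := [isSub for lip_fun].
HB.instance Definition _ := [Choice of Lip by <:].
HB.instance Definition _ := [SubChoice_isSubLmodule of Lip by <:].

Record Lipb := MkLipb { lipb_fun :> X -> R; lipb_funP : lipb_fun \in lipb_pred }.
HB.instance Definition _ := [isSub for lipb_fun].
HB.instance Definition _ := [Choice of Lipb by <:].
HB.instance Definition _ := [SubChoice_isSubLmodule of Lipb by <:].

Lemma lip_of_lipb_subproof (f : Lipb) : (f : X -> R) \in lip_pred.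
Proof. by have /asboolP[fL _] := lipb_funP f; apply/asboolP. Qed.

Definition lip_of_lipb (f : Lipb) : Lip := MkLip (lip_of_lipb_subproof f).

Lemma lipb1_subproof : (cst 1 : X -> R) \in lipb_pred.
Proof.
apply/asboolP; split; last by exists 1 => x; rewrite normr1.
by exists 0; split=> // x y; rewrite subrr normr0 mul0r.
Qed.

Definition lipb1 : Lipb := MkLipb lipb1_subproof.

Definition lip_const f : R := inf [set K | lip_bound f K].

Definition ptlip_scale (r : R) f (x : X) : \bar R :=
  ereal_sup [set ereal_sup [set (`|f x - f y| / s)%:E
                           | y in [set y | mdist x y < s]]
            | s in [set s : R | 0 < s < r]].

Definition ptlip f (x : X) : \bar R := lim (ptlip_scale r f x @[r --> 0^'+]).

End lipschitz_spaces.

Section currents.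
Context {R : realType} (X : completeMetricType R).

Definition functional (m : nat) := Lipb X -> ('I_m -> Lip X) -> R.

Section dimension.
Variable m : nat.
Implicit Types (T : functional m) (f : Lipb X) (pi : 'I_m -> Lip X).

Definition multilinear T :=
  (forall (a : R) f g pi, T (a *: f + g) pi = a * T f pi + T g pi) /\
  (forall (a : R) f pi i (u v : Lip X),
     T f (dfwith pi i (a *: u + v)) =
     a * T f (dfwith pi i u) + T f (dfwith pi i v)).

Definition current_continuity T :=
  forall f (pij : nat -> 'I_m -> Lip X) pi,
    (forall i x, pij j i x @[j --> \oo] --> pi i x) ->
    (exists C : R, forall i j, lip_const (pij j i) <= C) ->
    T f (pij j) @[j --> \oo] --> T f pi.

Definition current_locality T :=
  forall f pi (B : 'I_m -> set (borel X)),
    (forall i, measurable (B i)) ->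
    (forall i, exists c : R, forall x, B i x -> pi i x = c) ->
    [set x | f x != 0] `<=` \bigcup_i B i ->
    T f pi = 0.

Definition mass_bound T (mu : {finite_measure set (borel X) -> \bar R}) :=
  forall f pi,
    (`|T f pi|%:E <=
     (\prod_(i < m) lip_const (pi i))%:E * \int[mu]_x (`|f x|)%:E)%E.

Definition is_current T :=
  [/\ multilinear T, current_continuity T, current_locality T
    & exists mu, mass_bound T mu].

Definition current_pred : {pred functional m} := fun T => `[< is_current T >].

End dimension.

Section additive_group.
Variable m : nat.
Implicit Types (T S : functional m).

Let measurable_norm_Lipb (f : Lipb X) :
  measurable_fun [set: borel X] (fun x : borel X => (`|f x|)%:E).
Proof.
apply/measurable_EFinP/measurableT_comp => //.
have /asboolP[[K [K0 fK]] _] := lipb_funP f.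
apply: (measurability _ (RGenOInfty.measurableE R)) => _ [_ [a ->] <-].
rewrite setTI; apply: sub_sigma_algebra.
have /continuousP : continuous (f : X -> R).
  move=> x; apply/cvgrPdist_lt => e e0.
  have K1 : 0 < K + 1 by rewrite ltr_wpDl.
  apply/nbhs_ballP; exists (e / (K + 1)) => /=; first by rewrite divr_gt0.
  move=> y; rewrite ballEmdist/= ltr_pdivlMr// => xy.
  rewrite (le_lt_trans (fK x y))// (le_lt_trans _ xy)// mulrC.
  by rewrite ler_wpM2l// ?mdist_ge0// lerDl.
by apply; exact: rray_open.
Qed.

Let lip_const_ge0 (g : Lip X) : 0 <= lip_const g.
Proof.
have /asboolP[K gK] := lip_funP g.
by apply: lb_le_inf; [exists K|move=> L []].
Qed.

Let is_current0 : is_current (0 : functional m).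
Proof.
split.
- by split=> * /=; rewrite mulr0 addr0.
- by move=> *; exact: cvg_cst.
- by [].
- exists mzero => f pi /=.
  by rewrite normr0 mule_ge0// ?lee_fin ?prodr_ge0// integral_ge0.
Qed.

Let is_currentB T S : is_current T -> is_current S -> is_current (T - S).
Proof.
move=> [[T1 T2] Tc Tl [mu Tmu]] [[S1 S2] Sc Sl [nu Snu]]; split.
- split=> *; rewrite !fctE; first by rewrite T1 S1 mulrBr opprD addrACA.
  by rewrite T2 S2 mulrBr opprD addrACA.
- by move=> f pij pi pi_cvg piC; apply: cvgB; [exact: Tc|exact: Sc].
- move=> f pi B mB piB fB; rewrite !fctE.
  by rewrite (Tl _ _ _ mB piB fB) (Sl _ _ _ mB piB fB) subrr.
- have fin : fin_num_fun (measure_add mu nu).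
    by move=> A mA; rewrite measure_addE fin_numD !fin_num_measure.
  pose rho : {finite_measure set (borel X) -> \bar R} :=
    HB.pack (msum (fun n => if n is 0%N then mu : {measure set _ -> \bar R}
                            else nu) 2)
      (Measure_isFinite.Build _ (borel X) R (measure_add mu nu) fin).
  exists rho => f pi; rewrite !fctE ge0_integral_measure_add//.
  rewrite ge0_muleDr ?integral_ge0//.
  apply: le_trans (leeD (Tmu f pi) (Snu f pi)).
  by rewrite -EFinD lee_fin ler_normB.
Qed.

Lemma current_zmod_closed : zmod_closed (@current_pred m).
Proof.
split=> [|T S /asboolP cT /asboolP cS]; apply/asboolP; first exact: is_current0.
exact: is_currentB.
Qed.

HB.instance Definition _ :=
  GRing.isZmodClosed.Build (functional m) (@current_pred m) current_zmod_closed.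

Record current := MkCurrent {
  current_fun :> Lipb X -> ('I_m -> Lip X) -> R;
  current_funP : current_fun \in @current_pred m }.
HB.instance Definition _ := [isSub for current_fun].
HB.instance Definition _ := [Choice of current by <:].
HB.instance Definition _ := [SubChoice_isSubZmodule of current by <:].

End additive_group.

(* "Minimal" is read as least: the order on measures is setwise. *)
Definition is_mass m (T : functional m)
    (mu : {finite_measure set (borel X) -> \bar R}) :=
  mass_bound T mu /\
  forall nu, mass_bound T nu ->
    forall A : set (borel X), measurable A -> (mu A <= nu A)%E.

(* The least measure is unique as a function on Borel sets. If there were none,
   [mass T] would be the zero measure, the most demanding value in the upper
   norm and upper gradient inequalities. *)
Definition mass m (T : current m) : {finite_measure set (borel X) -> \bar R} :=
  match pselect (exists mu, is_mass T mu) with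
  | left ex => projT1 (cid ex)
  | right _ => mzero
  end.

(* In general the boundary of a current need not have finite mass. *)
Definition boundary m (S : current m.+1) : functional m :=
  fun f pi => S (lipb1 X)
    (fun i => if unlift ord0 i is Some j then pi j else lip_of_lipb f).

Section cochains.
Variable m : nat.
Local Open Scope ereal_scope.

(* A cochain on [C] is given by a function of which only the values on [C]
   matter. *)
Definition cochain (C : set (current m)) (omega : current m -> \bar R) :=
  [/\ C 0%R, (forall T S, C T -> C S -> C (T - S)%R), omega 0%R = 0
    & forall T S, C T -> C S -> `|omega T| <= `|omega (T + S)%R| + `|omega S| ].

Definition upper_norm (C : set (current m)) (omega : current m -> \bar R)
    (h : X -> \bar R) :=
  [/\ measurable_fun [set: borel X] (h : borel X -> \bar R),
      forall x, 0 <= h x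
    & forall T, C T -> `|omega T| <= \int[mass T]_x h x].

Definition upper_gradient (C : set (current m)) (C' : set (current m.+1))
    (omega : current m -> \bar R) (g : X -> \bar R) :=
  [/\ measurable_fun [set: borel X] (g : borel X -> \bar R),
      forall x, 0 <= g x
    & forall T S, C T -> C' S -> boundary S = T ->
        `|omega T| <= \int[mass S]_x g x].

End cochains.
End currents.

(* Main.v *)
From HB Require Import structures.
Require Import Defs.
From mathcomp Require Import all_boot all_order all_algebra.
From mathcomp Require Import all_classical all_reals all_analysis.
From mathcomp Require Import measurable_realfun lra ring.
Import Order.TTheory GRing.Theory Num.Theory.
Import numFieldNormedType.Exports.
Set Implicit Arguments.
Unset Strict Implicit.
Unset Printing Implicit Defensive.
Local Open Scope classical_set_scope.
Local Open Scope ring_scope.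

(** The pointwise bound [|T(f, pi)| <= \int |f| \prod_i Lip pi_i d||T||] contains both claims: it
    is the upper norm inequality, and applied to a current [S] in dimension [m + 1] at
    [(1, f, pi_1, .., pi_m)] it is the upper gradient inequality, since [\partial S (f, pi)] is by
    definition [S(1, f, pi)].  It holds for every measure [mu] with [mass_bound T mu].

    The Lipschitz constant of one [pi_k] is localized at a time.  If [pi_k] is [K]-Lipschitz on a
    Borel set [A], replace it by a [K]-Lipschitz function [w] equal to [pi_k] on [A]
    ([lip_extension]).  A quantitative form of locality ([current_local_bound]) bounds the error
    by [C \int_{pi_k != w} |f| dmu], which only sees the complement of [A].  Two bounds for the
    same functional may be glued along a Borel set ([dominated_glue]), because the functional is
    additive in [f] and Lipschitz functions approximate indicators of Borel sets in mean
    ([borel_lip_approx]).  Hence on [A] the constant [K] may be used, and [Lip(pi_k)] elsewhere.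
    Let [A] run over the sets where the oscillation of [pi_k] at scale [r] is at most [K]
    and [pi_k] lies in an interval of length [K r], for [r = 1/(n+1)] and [K] rational:
    [pi_k] is [K]-Lipschitz on such a set ([slice_lip]), countably many of them are enough in
    any complete metric space, separable or not, and the infimum of the resulting
    densities is the pointwise constant.  Passing to this infimum is [dominated_inf].

    It remains to see that a least bounding measure exists, so that [||T||] is itself a
    bounding measure ([mass_exists]).  Gluing along a Hahn decomposition shows that the minimum
    of two bounding measures is a bounding measure, and so is the limit of a decreasing sequence of
    them; a limit whose total mass is the infimum of all possible total masses is the least one. *)

(** * Bounded measurable functions *)

Section bounded_measurable.
Context d (T : measurableType d) (R : realType).
Implicit Types (g h : T -> R) (mu nu : {finite_measure set T -> \bar R}).

Definition bmeas g :=
  measurable_fun [set: T] g /\ exists M, forall x, `|g x| <= M.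

Lemma bmeas_cst (c : R) : bmeas (fun=> c).
Proof. by split; [exact: measurable_cst|exists `|c|]. Qed.

Lemma bmeasD g h : bmeas g -> bmeas h -> bmeas (fun x => g x + h x).
Proof.
move=> [mg [M gM]] [mh [N hN]]; split; first exact: measurable_funD.
by exists (M + N) => x; rewrite (le_trans (ler_normD _ _))// lerD.
Qed.

Lemma bmeasM g h : bmeas g -> bmeas h -> bmeas (fun x => g x * h x).
Proof.
move=> [mg [M gM]] [mh [N hN]]; split; first exact: measurable_funM.
by exists (M * N) => x; rewrite normrM ler_pM.
Qed.

Lemma bmeasB g h : bmeas g -> bmeas h -> bmeas (fun x => g x - h x).
Proof.
move=> bg bh; have := bmeasD bg (bmeasM (bmeas_cst (-1)) bh).
by congr bmeas; apply/funext => x; rewrite mulN1r.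
Qed.

Lemma bmeas_norm g : bmeas g -> bmeas (fun x => `|g x|).
Proof.
move=> [mg [M gM]]; split; first exact: measurableT_comp.
by exists M => x; rewrite normr_id.
Qed.

Lemma bmeas_min g h : bmeas g -> bmeas h -> bmeas (fun x => Num.min (g x) (h x)).
Proof.
move=> [mg [M gM]] [mh [N hN]]; split; first exact: measurable_minr.
exists (Num.max M N) => x; rewrite le_max.
by case: (leP (g x) (h x)) => _; rewrite ?gM ?hN ?orbT.
Qed.

Lemma bmeas_max g h : bmeas g -> bmeas h -> bmeas (fun x => Num.max (g x) (h x)).
Proof.
move=> [mg [M gM]] [mh [N hN]]; split; first exact: measurable_maxr.
exists (Num.max M N) => x; rewrite le_max.
by case: (leP (g x) (h x)) => _; rewrite ?gM ?hN ?orbT.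
Qed.

Lemma bmeas_indic (A : set T) : measurable A -> bmeas (\1_A : T -> R).
Proof.
move=> mA; split; first exact: measurable_indic.
by exists 1 => x; rewrite indicE; case: (_ \in _); rewrite /= ?normr1 ?normr0.
Qed.

Lemma bmeas_prod (I : Type) (r : seq I) (g : I -> T -> R) :
  (forall i, bmeas (g i)) -> bmeas (fun x => \prod_(i <- r) g i x).
Proof.
move=> bg; elim: r => [|i r IHr].
  have := bmeas_cst 1; congr bmeas.
  by apply/funext => x; rewrite big_nil.
have := bmeasM (bg i) IHr; congr bmeas.
by apply/funext => x; rewrite big_cons.
Qed.

Lemma bmeas_integrable mu g : bmeas g -> mu.-integrable setT (EFin \o g).
Proof.
move=> [mg [M gM]]; apply: measurable_bounded_integrable => //.
  by rewrite -ge0_fin_numE// fin_num_measure.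
exists M; split; first by rewrite num_real.
by move=> N MN x _; exact: le_trans (gM x) (ltW MN).
Qed.

Lemma bmeas_EFin_Rintegral mu g : bmeas g ->
  (\int[mu]_x g x)%:E = (\int[mu]_x (g x)%:E)%E.
Proof.
by move=> bg; rewrite fineK// integrable_fin_num//; exact: bmeas_integrable.
Qed.

Lemma bmeas_le_Rintegral mu g h : bmeas g -> bmeas h ->
  (forall x, g x <= h x) -> \int[mu]_x g x <= \int[mu]_x h x.
Proof. by move=> bg bh gh; apply: le_Rintegral => //; exact: bmeas_integrable. Qed.

Lemma bmeas_RintegralD mu g h : bmeas g -> bmeas h ->
  \int[mu]_x (g x + h x) = \int[mu]_x g x + \int[mu]_x h x.
Proof. by move=> bg bh; apply: RintegralD => //; exact: bmeas_integrable. Qed.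

Lemma bmeas_RintegralB mu g h : bmeas g -> bmeas h ->
  \int[mu]_x (g x - h x) = \int[mu]_x g x - \int[mu]_x h x.
Proof. by move=> bg bh; apply: RintegralB => //; exact: bmeas_integrable. Qed.

Lemma bmeas_RintegralZ mu (c : R) g : bmeas g ->
  \int[mu]_x (c * g x) = c * \int[mu]_x g x.
Proof. by move=> bg; apply: RintegralZl => //; exact: bmeas_integrable. Qed.

Lemma bmeas_Rintegral_mono mu nu g : bmeas g -> (forall x, 0 <= g x) ->
  (forall A, measurable A -> (mu A <= nu A)%E) ->
  \int[mu]_x g x <= \int[nu]_x g x.
Proof.
move=> bg g0 munu; rewrite -lee_fin !bmeas_EFin_Rintegral//.
apply: ge0_le_measure_integral => //.
by apply/measurable_EFinP; case: bg.
Qed.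

Lemma Rintegral_cst1 mu : \int[mu]_x (1 : R) = fine (mu setT).
Proof. by rewrite /Rintegral integral_cst// mul1e. Qed.

Lemma bmeas_dominated_cvg mu (g_ : nat -> T -> R) g (C : R) :
    (forall n, bmeas (g_ n)) -> bmeas g -> (forall n x, `|g_ n x| <= C) ->
    (forall x, g_ n x @[n --> \oo] --> g x) ->
  \int[mu]_x g_ n x @[n --> \oo] --> \int[mu]_x g x.
Proof.
move=> bg_ bg gC cvg.
have [| | | | |_ _] := @dominated_convergence _ _ _ mu setT measurableT
    (fun n => EFin \o g_ n) (EFin \o g) (EFin \o cst C).
- by move=> n; apply/measurable_EFinP; case: (bg_ n).
- by apply/measurable_EFinP; case: bg.
- by apply/aeW => x _ /=; apply: cvg_EFin => //; [exact: nearW|exact: cvg].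
- by apply: bmeas_integrable; exact: bmeas_cst.
- by apply/aeW => x n _ /=; rewrite lee_fin.
by move=> h; apply: fine_cvg; rewrite bmeas_EFin_Rintegral.
Qed.

End bounded_measurable.

(** * Lipschitz functions *)

Section lipschitz_calculus.
Context {R : realType} {X : completeMetricType R}.
Implicit Types (f g : X -> R).

Lemma is_lip_cst (c : R) : is_lip (fun _ : X => c).
Proof. by exists 0; split=> // x y; rewrite subrr normr0 mul0r. Qed.

Lemma is_lip_comp (phi : R -> R) (K : R) f : 0 <= K ->
  (forall s t, `|phi s - phi t| <= K * `|s - t|) ->
  is_lip f -> is_lip (fun x => phi (f x)).
Proof.
move=> K0 phiK [L [L0 fL]]; exists (K * L); split=> [|x y]; first exact: mulr_ge0.
by rewrite (le_trans (phiK _ _))// -mulrA ler_wpM2l.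
Qed.

Lemma is_lip_max f g : is_lip f -> is_lip g ->
  is_lip (fun x => Num.max (f x) (g x)).
Proof.
move=> [K [K0 fK]] [L [L0 gL]]; exists (K + L); split=> [|x y].
  exact: addr_ge0.
have := fK x y; have := gL x y; have d0 := mdist_ge0 x y.
have Kd : 0 <= K * mdist x y by exact: mulr_ge0.
have Ld : 0 <= L * mdist x y by exact: mulr_ge0.
rewrite mulrDl !ler_norml => /andP[? ?] /andP[? ?].
by case: (leP (f x) (g x)) => ?; case: (leP (f y) (g y)) => ?; apply/andP; split; lra.
Qed.

Lemma lipb_bounded (f : Lipb X) : exists2 M, 0 <= M & forall x, `|f x| <= M.
Proof.
have /asboolP[_ [M fM]] := lipb_funP f.
by exists M => //; exact: le_trans (fM point).
Qed.

Lemma is_lipb_mul (f g : Lipb X) : (fun x => f x * g x) \in lipb_pred (X := X).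
Proof.
have /asboolP[[K [K0 fK]] _] := lipb_funP f.
have /asboolP[[L [L0 gL]] _] := lipb_funP g.
have [M M0 fM] := lipb_bounded f; have [N N0 gN] := lipb_bounded g.
apply/asboolP; split; last by exists (M * N) => x; rewrite normrM ler_pM.
exists (M * L + N * K); split=> [|x y]; first by rewrite addr_ge0 ?mulr_ge0.
have -> : f x * g x - f y * g y = f x * (g x - g y) + g y * (f x - f y) by ring.
rewrite (le_trans (ler_normD _ _))// mulrDl !normrM -!mulrA.
by rewrite lerD// ler_pM// ?fM ?gN.
Qed.

Definition lipb_mul (f g : Lipb X) : Lipb X := MkLipb (is_lipb_mul f g).

Lemma lipb_mul_split (f u : Lipb X) :
  f = lipb_mul f u + lipb_mul f (lipb1 X - u).
Proof.
apply/val_inj/funext => x /=.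
by rewrite !fctE /=; ring.
Qed.

Lemma lipb_exists f : is_lip f -> is_bounded f -> exists u : Lipb X, u = f :> (X -> R).
Proof.
move=> fL fb; have p : f \in lipb_pred (X := X) by apply/asboolP.
by exists (MkLipb p).
Qed.

Lemma lip_exists f : is_lip f -> exists u : Lip X, u = f :> (X -> R).
Proof.
move=> fL; have p : f \in lip_pred (X := X) by apply/asboolP.
by exists (MkLip p).
Qed.

Lemma lip_lip (w : Lip X) : is_lip w.
Proof. by have /asboolP := lip_funP w. Qed.

Lemma lipb_lip (w : Lipb X) : is_lip w.
Proof. by have /asboolP[] := lipb_funP w. Qed.

Lemma is_lip_continuous f : is_lip f -> continuous f.
Proof.
move=> [K [K0 fK]] x; apply/cvgrPdist_lt => e e0.
have K1 : 0 < K + 1 by rewrite ltr_wpDl.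
apply/nbhs_ballP; exists (e / (K + 1)) => /=; first by rewrite divr_gt0.
move=> y; rewrite ballEmdist/= ltr_pdivlMr// => xy.
rewrite (le_lt_trans (fK x y))// (le_lt_trans _ xy)// mulrC.
by rewrite ler_wpM2l// ?mdist_ge0// lerDl.
Qed.

Lemma open_measurable_borel (U : set X) : open U -> measurable (U : set (borel X)).
Proof. by move=> oU; exact: sub_sigma_algebra. Qed.

Lemma is_lip_measurable f : is_lip f -> measurable_fun [set: borel X] (f : borel X -> R).
Proof.
move=> /is_lip_continuous/continuousP cf.
apply: (measurability _ (RGenOInfty.measurableE R)) => _ [_ [a ->] <-].
rewrite setTI; apply: open_measurable_borel.
by apply: cf; exact: rray_open.
Qed.

Lemma lipb_bmeas (f : Lipb X) : bmeas (f : borel X -> R).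
Proof.
split; first by apply: is_lip_measurable; exact: lipb_lip.
by have [M _ fM] := lipb_bounded f; exists M.
Qed.

Lemma lip_const_lb f K : lip_bound f K -> lip_const f <= K.
Proof. by move=> fK; apply: ge_inf => //; exists 0 => L []. Qed.

Lemma lip_const_ge0 f : is_lip f -> 0 <= lip_const f.
Proof. by move=> [K fK]; apply: lb_le_inf; [exists K|move=> L []]. Qed.

(** The infimum is attained: the Lipschitz inequality is closed in the constant. *)
Lemma lip_constP f : is_lip f -> lip_bound f (lip_const f).
Proof.
move=> fL; split; first exact: lip_const_ge0.
move=> x y; have [->|xy] := eqVneq x y; first by rewrite subrr normr0 mdistxx mulr0.
have d0 : 0 < mdist x y by rewrite mdist_gt0.
rewrite -ler_pdivrMr//; apply: lb_le_inf; first by case: fL => K; exists K.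
by move=> K [_ fK]; rewrite ler_pdivrMr.
Qed.

(** A distance to [K] truncated at 1, so that it is meaningful for [K] empty too. *)
Definition dist1 (K : set X) (x : X) : R := inf (1 |` [set @mdist R X x y | y in K]).

Lemma dist1_has_inf K x : has_inf (1 |` [set @mdist R X x y | y in K]).
Proof.
split; first by exists 1; left.
by exists 0 => _ [->|[y _ <-]]; rewrite ?ler01 ?mdist_ge0.
Qed.

Lemma dist1_ge0 K x : 0 <= dist1 K x.
Proof.
apply: lb_le_inf; first by exists 1; left.
by move=> _ [->|[y _ <-]]; rewrite ?ler01 ?mdist_ge0.
Qed.

Lemma dist1_le1 K x : dist1 K x <= 1.
Proof. by apply: ge_inf; [exact: (dist1_has_inf K x).2|left]. Qed.

Lemma dist1_mem K x : K x -> dist1 K x = 0.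
Proof.
move=> Kx; apply/eqP; rewrite eq_le dist1_ge0 andbT -(mdistxx x).
by apply: ge_inf; [exact: (dist1_has_inf K x).2|right; exists x].
Qed.

Lemma dist1_gt0 K x : closed K -> ~ K x -> 0 < dist1 K x.
Proof.
move=> cK Kx; have : nbhs x (~` K) by apply: open_nbhs_nbhs; split=> //; exact: closed_openC.
move=> /nbhs_ballP[e /= e0 eK].
apply: (@lt_le_trans _ _ (Num.min 1 e)); first by rewrite lt_min ltr01.
apply: lb_le_inf; first by exists 1; left.
move=> _ [->|[y Ky <-]]; rewrite ge_min ?lexx//; apply/orP; right.
by rewrite leNgt; apply/negP => xy; apply: (eK y) => //; rewrite ballEmdist.
Qed.

Lemma dist1_lip K : is_lip (dist1 K).
Proof.
exists 1; split=> // x y; rewrite mul1r.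
suff H a b : dist1 K a <= mdist a b + dist1 K b.
  have := H x y; have := H y x; rewrite (metric_sym y x) ler_norml => ? ?.
  by apply/andP; split; lra.
rewrite -lerBlDl; apply: lb_le_inf; first by exists 1; left.
move=> _ [->|[z Kz <-]]; rewrite lerBlDl.
  by rewrite (le_trans (dist1_le1 _ _))// lerDr mdist_ge0.
apply: (le_trans _ (metric_triangle a b z)).
by apply: ge_inf; [exact: (dist1_has_inf K a).2|right; exists z].
Qed.

(** McShane's extension: the infimal convolution of [f] with a cone of slope [K]. *)
Lemma lip_extension (A : set X) f (K : R) : 0 <= K ->
  (forall x y, A x -> A y -> `|f x - f y| <= K * mdist x y) ->
  exists w : Lip X, lip_const w <= K /\ forall x, A x -> w x = f x.
Proof.
move=> K0 fK.
have [[a Aa]|A0] := pselect (A !=set0); last first.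
  have [w wE] := lip_exists (is_lip_cst 0).
  exists w; split=> [|x Ax]; last by case: A0; exists x.
  by apply: lip_const_lb; split=> // x y; rewrite wE subrr normr0 mulr_ge0 ?mdist_ge0.
pose E x := [set f y + K * mdist x y | y in A].
have lbE x : lbound (E x) (f a - K * mdist x a).
  move=> _ [y Ay <-].
  have := fK _ _ Aa Ay; rewrite ler_norml => /andP[_ ?].
  have := metric_triangle a x y; rewrite (metric_sym a x) => /(ler_wpM2l K0).
  by rewrite mulrDr => ?; lra.
have hE x : has_inf (E x) by split; [exists (f a + K * mdist x a), a|eexists; exact: lbE].
have H x y : inf (E x) <= K * mdist x y + inf (E y).
  rewrite -lerBlDl; apply: lb_le_inf; first by case: (hE y).
  move=> _ [z Az <-]; rewrite lerBlDl.
  apply: (@le_trans _ _ (f z + K * mdist x z)).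
    by apply: ge_inf; [exact: (hE x).2|exists z].
  by have := ler_wpM2l K0 (metric_triangle x y z); rewrite mulrDr; lra.
have EK : lip_bound (fun x => inf (E x)) K.
  split=> // x y; have := H x y; have := H y x; rewrite (metric_sym y x) ler_norml => ? ?.
  by apply/andP; split; lra.
have [w wE] : exists u : Lip X, u = (fun x => inf (E x)) :> (X -> R).
  by apply: lip_exists; exists K.
exists w; split; rewrite wE; first exact: lip_const_lb.
move=> x Ax; apply/eqP; rewrite eq_le; apply/andP; split.
  by apply: ge_inf; [exact: (hE x).2|exists x => //; rewrite mdistxx mulr0 addr0].
apply: lb_le_inf; first by case: (hE x).
by move=> _ [y Ay <-]; have := fK _ _ Ax Ay; rewrite ler_norml => /andP[_ ?]; lra.
Qed.

End lipschitz_calculus.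

(** * Lipschitz functions approximate Borel sets *)

Section density.
Context {R : realType} {X : completeMetricType R}.
Implicit Types (mu nu : {finite_measure set (borel X) -> \bar R}) (f u : Lipb X).

Lemma indic_le1 (T : Type) (A : set T) x : 0 <= (\1_A x : R) <= 1.
Proof. by rewrite indicE; case: (_ \in _); rewrite /= ?lexx ?ler01. Qed.

Lemma lipb1BE u x : (lipb1 X - u) x = 1 - u x.
Proof. by []. Qed.

Lemma indic_setC (T : Type) (A : set T) x : \1_(~` A) x = 1 - \1_A x :> R.
Proof. by rewrite !indicE in_setC; case: (_ \in _); rewrite /= ?subrr ?subr0. Qed.

Definition lip_approx mu (A : set (borel X)) := measurable A /\
  forall e : R, 0 < e -> exists u, (forall x, 0 <= u x <= 1) /\
    \int[mu]_x `|u x - \1_A x| <= e.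

Let bmeas_err u (A : set (borel X)) : measurable A ->
  bmeas (fun x : borel X => `|u x - \1_A x|).
Proof.
by move=> mA; apply/bmeas_norm/bmeasB; [exact: lipb_bmeas|exact: bmeas_indic].
Qed.

Lemma lip_approx_set0 mu : lip_approx mu set0.
Proof.
split=> // e e0; exists 0; split=> [x|]; first by rewrite lexx ler01.
rewrite (@eq_Rintegral _ _ _ _ _ (cst 0)); last first.
  by move=> x _; rewrite indic0 subrr normr0.
by rewrite /Rintegral integral0 ltW.
Qed.

Lemma lip_approxC mu A : lip_approx mu A -> lip_approx mu (~` A).
Proof.
move=> [mA H]; split; first exact: measurableC.
move=> e /H[u [u01 ue]]; exists (lipb1 X - u); split=> [x|].
  by have /andP[? ?] := u01 x; rewrite lipb1BE; apply/andP; split; lra.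
rewrite (le_trans _ ue)//; apply: bmeas_le_Rintegral.
- exact/bmeas_err/measurableC.
- exact: bmeas_err.
- move=> x; rewrite lipb1BE indic_setC -normrN le_eqVlt; apply/orP; left.
  by apply/eqP; congr `|_|; ring.
Qed.

Lemma lip_approxU mu A B : lip_approx mu A -> lip_approx mu B ->
  lip_approx mu (A `|` B).
Proof.
move=> [mA HA] [mB HB]; split; first exact: measurableU.
move=> e e0; have e20 : 0 < e / 2 by rewrite divr_gt0.
have [u [u01 ue]] := HA _ e20; have [v [v01 ve]] := HB _ e20.
have [w wE] : exists w : Lipb X, w = (fun x => Num.max (u x) (v x)) :> (X -> R).
  apply: lipb_exists; first by apply: is_lip_max; exact: lipb_lip.
  exists 1 => x; have /andP[? ?] := u01 x; have /andP[? ?] := v01 x.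
  by rewrite ger0_norm ?ge_max ?le_max; apply/andP || apply/orP; [split|left].
exists w; split=> [x|].
  have /andP[u0 u1] := u01 x; have /andP[v0 v1] := v01 x.
  by rewrite wE le_max u0 ge_max u1 v1.
apply: (@le_trans _ _ (\int[mu]_x (`|u x - \1_A x| + `|v x - \1_B x|))).
  apply: bmeas_le_Rintegral.
  - exact/bmeas_err/measurableU.
  - by apply: bmeasD; exact: bmeas_err.
  - move=> x; rewrite wE !indicE in_setU.
    have /andP[u0 u1] := u01 x; have /andP[v0 v1] := v01 x.
    case: (x \in A); case: (x \in B) => /=; case: (leP (u x) (v x)) => ?;
      rewrite ?subr0 ?(ger0_norm u0) ?(ger0_norm v0);
      rewrite ?[`|u x - 1|]ler0_norm ?[`|v x - 1|]ler0_norm; lra.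
rewrite bmeas_RintegralD; [|exact: bmeas_err|exact: bmeas_err].
by rewrite [leRHS]splitr lerD.
Qed.

Lemma lip_approx_cvg mu (F : nat -> set (borel X)) A : measurable A ->
  (forall n, lip_approx mu (F n)) ->
  (forall x, (\1_(F n) x : R) @[n --> \oo] --> (\1_A x : R)) -> lip_approx mu A.
Proof.
move=> mA aF FA; split=> // e e0; have e20 : 0 < e / 2 by rewrite divr_gt0.
have bF n : bmeas (\1_(F n) : borel X -> R) by apply: bmeas_indic; case: (aF n).
have bd n : bmeas (fun x : borel X => `|\1_(F n) x - \1_A x| : R).
  by apply/bmeas_norm/bmeasB => //; exact: bmeas_indic.
have /cvgrPdist_le/(_ _ e20)[n _ /(_ n (leqnn n)) nP] :
    \int[mu]_x `|\1_(F n) x - \1_A x| @[n --> \oo] --> \int[mu]_x (0 : R).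
  apply: (@bmeas_dominated_cvg _ _ _ _ _ _ 1) => //; first exact: bmeas_cst.
    move=> n x; rewrite normr_id ler_norml.
    have /andP[? ?] := indic_le1 (F n) x; have /andP[? ?] := indic_le1 A x.
    by apply/andP; split; lra.
  move=> x; rewrite -(normr0 R); apply: cvg_norm; rewrite -(subrr (\1_A x)).
  by apply: cvgB; [exact: FA|exact: cvg_cst].
have [_ /(_ _ e20)[u [u01 ue]]] := aF n; exists u; split=> //.
apply: (@le_trans _ _ (\int[mu]_x (`|u x - \1_(F n) x| + `|\1_(F n) x - \1_A x|))).
  apply: bmeas_le_Rintegral; first exact: bmeas_err.
    by apply: bmeasD => //; apply: bmeas_err; case: (aF n).
  by move=> x; exact: ler_distD.
rewrite bmeas_RintegralD//; last by apply: bmeas_err; case: (aF n).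
rewrite [leRHS]splitr lerD//.
move: nP; rewrite [X in `|X - _|](_ : _ = 0); last by rewrite /Rintegral integral0.
by rewrite sub0r normrN; apply: le_trans; exact: ler_norm.
Qed.

Lemma lip_approx_bigcup mu (F : nat -> set (borel X)) :
  (forall n, lip_approx mu (F n)) -> lip_approx mu (\bigcup_n F n).
Proof.
move=> aF; apply: (@lip_approx_cvg _ (fun n => \big[setU/set0]_(i < n) F i)).
- by apply: bigcup_measurable => n _; case: (aF n).
- elim=> [|n IHn]; first by rewrite big_ord0; exact: lip_approx_set0.
  by rewrite big_ord_recr; exact: lip_approxU.
- move=> x; apply: cvg_near_cst; rewrite !indicE.
  have [/set_mem[N _ FN]|xF] := boolP (x \in \bigcup_n F n).
    exists N.+1 => // n /= Nn; rewrite indicE (mem_set (A := \big[_/_]_(_ < _) _))//.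
    by rewrite -bigcup_mkord; exists N.
  apply: nearW => n; rewrite indicE memNset//.
  by rewrite -bigcup_mkord => -[k _ Fk]; move/negP: xF; apply; apply/mem_set; exists k.
Qed.

(** An open set is the increasing limit of the functions [min 1 (n d)], with [d] the
    distance to its complement. *)
Lemma lip_approx_open mu (U : set X) : open U -> lip_approx mu (U : set (borel X)).
Proof.
move=> oU; have mU := open_measurable_borel oU; split=> // e e0.
have cU : closed (~` U) by exact: open_closedC.
pose v n (x : X) := Num.min 1 (n%:R * dist1 (~` U) x).
have v0 n x : 0 <= v n x by rewrite le_min ler01 mulr_ge0// dist1_ge0.
have v1 n x : v n x <= 1 by rewrite ge_min lexx.
have vn n : exists u : Lipb X, u = v n :> (X -> R).
  apply: lipb_exists; last by exists 1 => x; rewrite ger0_norm.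
  apply: (@is_lip_comp _ _ (fun t => Num.min 1 (n%:R * t)) n%:R) => //; last exact: dist1_lip.
  move=> s t; rewrite -[n%:R in leRHS]ger0_norm// -normrM mulrBr.
  set a := n%:R * s; set b := n%:R * t.
  have := ler_norm (a - b); have := ler_norm (b - a); rewrite (distrC b a) => ? ?.
  rewrite ler_norml; case: (leP 1 a) => ?; case: (leP 1 b) => ?; apply/andP; split; lra.
pose w n := projT1 (cid (vn n)).
have wE n x : w n x = v n x by rewrite /w; case: cid => u /= ->.
have : \int[mu]_x `|w n x - \1_U x| @[n --> \oo] --> \int[mu]_x (0 : R).
  apply: (@bmeas_dominated_cvg _ _ _ _ _ _ 1).
  - by move=> n; exact: bmeas_err.
  - exact: bmeas_cst.
  - move=> n x; rewrite normr_id wE ler_norml.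
    have /andP[? ?] := indic_le1 U x; have := v0 n x; have := v1 n x => ? ?.
    by apply/andP; split; lra.
  move=> x; apply: cvg_near_cst; have [Ux|Ux] := pselect (U x); last first.
    apply: nearW => n; rewrite wE /v indicE memNset// dist1_mem// mulr0 subr0.
    by rewrite min_r// normr0.
  have d0 : 0 < dist1 (~` U) x by apply: dist1_gt0 => //; exact/contrapT.
  exists (Num.Def.trunc (dist1 (~` U) x)^-1).+1 => // n /= dn.
  rewrite wE /v indicE mem_set// min_l ?subrr ?normr0//.
  rewrite -ler_pdivrMr// div1r; apply: ltW; apply: lt_le_trans (truncnS_gt _) _.
  by rewrite ler_nat.
rewrite /Rintegral integral0 => /cvgrPdist_le/(_ _ e0)[n _ /(_ n (leqnn n)) nP].
exists (w n); split=> [x|]; first by rewrite wE v0 v1.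
by move: nP; rewrite sub0r normrN; apply: le_trans; exact: ler_norm.
Qed.

(** The approximable sets form a sigma-algebra containing the open sets. *)
Lemma borel_lip_approx mu A : measurable A -> lip_approx mu A.
Proof.
suff : @measurable _ (borel X) `<=` lip_approx mu by exact.
apply: smallest_sub => [|U oU]; last exact: lip_approx_open.
split; first exact: lip_approx_set0.
- by move=> B aB; rewrite setTD; exact: lip_approxC.
- exact: lip_approx_bigcup.
Qed.

Lemma finite_measure_sum mu nu :
  exists rho : {finite_measure set (borel X) -> \bar R},
    forall A, rho A = (mu A + nu A)%E.
Proof.
have fin : fin_num_fun (measure_add mu nu).
  by move=> A mA; rewrite measure_addE fin_numD !fin_num_measure.
pose rho : {finite_measure set (borel X) -> \bar R} :=
  HB.pack (msum (fun n => if n is 0%N then mu : {measure set _ -> \bar R}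
                          else nu) 2)
    (Measure_isFinite.Build _ (borel X) R (measure_add mu nu) fin).
by exists rho => A; exact: measure_addE.
Qed.

Lemma lip_approx2 mu nu A (e : R) : measurable A -> 0 < e ->
  exists u, [/\ forall x, 0 <= u x <= 1, \int[mu]_x `|u x - \1_A x| <= e
    & \int[nu]_x `|u x - \1_A x| <= e].
Proof.
move=> mA e0; have [rho rhoE] := finite_measure_sum mu nu.
have [_ /(_ _ e0)[u [u01 ue]]] := borel_lip_approx rho mA.
exists u; split=> //; apply: (le_trans _ ue); apply: bmeas_Rintegral_mono;
  by [exact: bmeas_err|move=> B mB; rewrite rhoE ?leeDl ?leeDr|].
Qed.

End density.

(** * Bounds for functionals on bounded Lipschitz functions *)

Section domination.
Context {R : realType} {X : completeMetricType R} (L : Lipb X -> R).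
Hypothesis L_add : forall f g, L (f + g) = L f + L g.
Implicit Types (mu nu : {finite_measure set (borel X) -> \bar R}).
Implicit Types (theta : borel X -> R).

Definition dominated mu theta := [/\ bmeas theta, forall x, 0 <= theta x
  & forall f : Lipb X, `|L f| <= \int[mu]_x (`|f x| * theta x)].

Lemma bmeas_lipb_mul (f : Lipb X) theta : bmeas theta ->
  bmeas (fun x : borel X => `|f x| * theta x).
Proof. by move=> bt; apply: bmeasM => //; apply: bmeas_norm; exact: lipb_bmeas. Qed.

Lemma dominated_le mu theta theta' : dominated mu theta -> bmeas theta' ->
  (forall x, theta x <= theta' x) -> dominated mu theta'.
Proof.
move=> [bt t0 tL] bt' tt'; split=> // [x|f]; first exact: le_trans (tt' x).
rewrite (le_trans (tL f))//; apply: bmeas_le_Rintegral; try exact: bmeas_lipb_mul.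
by move=> x; rewrite ler_wpM2l.
Qed.

(** Two bounds may be combined, using one on [A] and the other off [A]: split [f] as
    [f u + f (1 - u)] with [u] Lipschitz close to the indicator of [A]. *)
Lemma dominated_glue mu nu theta theta' (A : set (borel X)) : measurable A ->
  dominated mu theta -> dominated nu theta' ->
  forall f : Lipb X, `|L f| <= \int[mu]_x (`|f x| * (theta x * \1_A x)) +
    \int[nu]_x (`|f x| * (theta' x * \1_(~` A) x)).
Proof.
move=> mA [bt t0 tL] [bt' t0' tL'] f.
have [M M0 fM] := lipb_bounded f; have [_ [C tC]] := bt; have [_ [C' tC']] := bt'.
have C0 : 0 <= C by exact: le_trans (tC point).
have C0' : 0 <= C' by exact: le_trans (tC' point).
apply/ler_addgt0Pr => e e0; pose K := M * C + M * C' + 1.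
have K0 : 0 < K by rewrite ltr_wpDl// addr_ge0// mulr_ge0.
have [u [u01 ue ue']] := lip_approx2 mu nu mA (divr_gt0 e0 K0).
have bA : bmeas (\1_A : borel X -> R) by exact: bmeas_indic.
have bA' : bmeas (\1_(~` A) : borel X -> R) by apply: bmeas_indic; exact: measurableC.
have berr : bmeas (fun x : borel X => `|u x - \1_A x|).
  by apply/bmeas_norm/bmeasB => //; exact: lipb_bmeas.
have main (rho : {finite_measure set (borel X) -> \bar R}) (th : borel X -> R)
    (c : R) (B : set (borel X)) (v : Lipb X) : bmeas th -> (forall x, `|th x| <= c) ->
    (forall x, 0 <= th x) -> bmeas (\1_B : borel X -> R) -> 0 <= c ->
    (forall x, `|v x| - \1_B x <= `|u x - \1_A x|) ->
    \int[rho]_x `|u x - \1_A x| <= e / K ->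
    \int[rho]_x (`|lipb_mul f v x| * th x) <=
    \int[rho]_x (`|f x| * (th x * \1_B x)) + M * c * (e / K).
  move=> bth thc th0 bB c0 vB ve.
  have bfB : bmeas (fun x : borel X => `|f x| * (th x * \1_B x)).
    by apply: bmeas_lipb_mul; exact: bmeasM.
  have bMc : bmeas (fun x : borel X => M * c * `|u x - \1_A x|).
    by apply: bmeasM => //; exact: bmeas_cst.
  apply: (@le_trans _ _ (\int[rho]_x (`|f x| * (th x * \1_B x) + M * c * `|u x - \1_A x|))).
    apply: bmeas_le_Rintegral; [exact: bmeas_lipb_mul|exact: bmeasD|].
    move=> x; rewrite /= normrM -lerBlDl.
    have -> : `|f x| * `|v x| * th x - `|f x| * (th x * \1_B x) =
      `|f x| * th x * (`|v x| - \1_B x) by ring.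
    apply: (@le_trans _ _ (`|f x| * th x * `|u x - \1_A x|)).
      by rewrite ler_wpM2l// mulr_ge0.
    by rewrite ler_wpM2r// ler_pM// (le_trans (ler_norm _)).
  rewrite bmeas_RintegralD// bmeas_RintegralZ// lerD2l ler_wpM2l//.
  exact: mulr_ge0.
rewrite [in leLHS](lipb_mul_split f u) L_add (le_trans (ler_normD _ _))//.
have h1 := main mu theta C A u bt tC t0 bA C0 _ ue.
have h2 := main nu theta' C' (~` A) (lipb1 X - u) bt' tC' t0' bA' C0' _ ue'.
apply: (le_trans (lerD (le_trans (tL _) (h1 _)) (le_trans (tL' _) (h2 _)))).
- move=> x; have /andP[? _] := u01 x; rewrite ger0_norm//; exact: ler_norm.
- move=> x; have /andP[_ ?] := u01 x; rewrite lipb1BE ger0_norm ?subr_ge0//.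
  rewrite indic_setC; apply: le_trans (ler_norm _) _; rewrite -normrN.
  by rewrite le_eqVlt; apply/orP; left; apply/eqP; congr `|_|; ring.
- rewrite addrACA lerD2l -mulrDl mulrA ler_pdivrMr// mulrC ler_pM2l//.
  by rewrite /K lerDl.
Qed.

Lemma dominated_min mu theta theta' : dominated mu theta -> dominated mu theta' ->
  dominated mu (fun x => Num.min (theta x) (theta' x)).
Proof.
move=> dt dt'; have [bt t0 _] := dt; have [bt' t0' _] := dt'.
have bm := bmeas_min bt bt'.
split=> // [x|f]; first by rewrite le_min t0 t0'.
pose A : set (borel X) := [set x | theta x <= theta' x].
have mA : measurable A.
  have := measurable_fun_ler bt.1 bt'.1 measurableT (Y := [set true]) I.
  by rewrite setTI; congr measurable; apply/seteqP; split.
apply: (le_trans (dominated_glue mA dt dt' f)).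
have bA : bmeas (\1_A : borel X -> R) by exact: bmeas_indic.
have bA' : bmeas (\1_(~` A) : borel X -> R) by apply: bmeas_indic; exact: measurableC.
rewrite -bmeas_RintegralD; [|by apply: bmeas_lipb_mul; exact: bmeasM..].
apply: bmeas_le_Rintegral.
- by apply: bmeasD; apply: bmeas_lipb_mul; exact: bmeasM.
- exact: bmeas_lipb_mul.
- move=> x; rewrite !indicE in_setC -mulrDr.
  have -> : (x \in A) = (theta x <= theta' x).
    by apply/idP/idP => [/set_mem//|xA]; exact/mem_set.
  by case: (leP (theta x) (theta' x)) => _ /=; rewrite !(mulr1, mulr0, addr0, add0r).
Qed.

(** Densities of bounds may be replaced by their infimum over a countable family, by
    dominated convergence along the finite minima. *)
Lemma dominated_inf mu (theta_ : nat -> borel X -> R) theta :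
  (forall n, dominated mu (theta_ n)) -> bmeas theta -> (forall x, 0 <= theta x) ->
  (forall x (e : R), 0 < e -> exists n, theta_ n x <= theta x + e) ->
  dominated mu theta.
Proof.
move=> dt bt t0 tinf; split=> // f.
pose m_ := fix m_ n := if n is k.+1 then (fun x => Num.min (m_ k x) (theta_ n x))
                       else theta_ 0%N.
have dm n : dominated mu (m_ n).
  by elim: n => [|n IHn] /=; [exact: dt|exact: dominated_min].
have m_theta n k x : (k <= n)%N -> m_ n x <= theta_ k x.
  elim: n => [|n IHn]; first by rewrite leqn0 => /eqP ->.
  by rewrite leq_eqVlt => /predU1P[->|/IHn h]; rewrite /= ge_min ?lexx ?orbT ?h.
pose M_ n x := Num.max (m_ n x) (theta x).
have bM n : bmeas (M_ n) by apply: bmeas_max => //; case: (dm n).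
have dM n : dominated mu (M_ n).
  by apply: dominated_le (dm n) _ _ => // x; rewrite le_max lexx.
have [_ [C tC]] := bt; have [[_ [D tD]] _ _] := dt 0%N; have [M M0 fM] := lipb_bounded f.
have M0_ n x : 0 <= M_ n x by case: (dM n).
have MCD n x : `|M_ n x| <= Num.max D C.
  rewrite ger0_norm// ge_max !le_max.
  rewrite (le_trans (m_theta n 0%N x _) (le_trans (ler_norm _) (tD x)))//=.
  by rewrite (le_trans (ler_norm _) (tC x)) orbT.
have cM x : M_ n x @[n --> \oo] --> theta x.
  apply/cvgrPdist_le => e e0; have [k kP] := tinf x e e0.
  exists k => // n /= kn; rewrite distrC ger0_norm ?subr_ge0 ?le_max ?lexx ?orbT//.
  rewrite lerBlDl ge_max (le_trans (m_theta n k x kn))//=.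
  by rewrite lerDl ltW.
have : \int[mu]_x (`|f x| * M_ n x) @[n --> \oo] --> \int[mu]_x (`|f x| * theta x).
  apply: (@bmeas_dominated_cvg _ _ _ _ _ _ (M * Num.max D C)).
  - by move=> n; exact: bmeas_lipb_mul.
  - exact: bmeas_lipb_mul.
  - by move=> n x; rewrite normrM normr_id ler_pM.
  - by move=> x; apply: cvgM; [exact: cvg_cst|exact: cM].
move=> h; rewrite -(cvg_lim _ h)//; apply: limr_ge; first by apply/cvg_ex; eexists; exact: h.
by apply: nearW => n; case: (dM n).
Qed.

End domination.

(** * Locality *)

Section locality.
Context {R : realType} {X : completeMetricType R} {m : nat}.
Implicit Types (T : functional X m) (pi : 'I_m -> Lip X) (f g : Lipb X) (w : Lip X).
Implicit Types (mu : {finite_measure set (borel X) -> \bar R}).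

Lemma mass_boundR T mu f pi : mass_bound T mu ->
  `|T f pi| <= (\prod_(i < m) lip_const (pi i)) * \int[mu]_x `|f x|.
Proof.
move=> /(_ f pi); rewrite -[X in (_ <= _ * X)%E]bmeas_EFin_Rintegral -?EFinM ?lee_fin//.
by apply: bmeas_norm; exact: lipb_bmeas.
Qed.

Lemma multilinear_addl T pi f g : multilinear T -> T (f + g) pi = T f pi + T g pi.
Proof. by move=> [H _]; have := H 1 f g pi; rewrite scale1r mul1r. Qed.

Lemma multilinear_dfwithB T f pi i (u v : Lip X) : multilinear T ->
  T f (dfwith pi i u) = T f (dfwith pi i v) + T f (dfwith pi i (u - v)).
Proof.
move=> [_ H]; have := H 1 f pi i (u - v) v.
by rewrite scale1r subrK mul1r addrC.
Qed.

(** Soft thresholding at level [d]. *)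
Definition shrink (d t : R) : R := t - Num.max (- d) (Num.min d t).

Lemma shrink_lip d s t : 0 <= d -> `|shrink d s - shrink d t| <= 1 * `|s - t|.
Proof.
move=> d0; rewrite mul1r /shrink; have := ler_norm (s - t); have := ler_norm (t - s).
rewrite (distrC t s) => ? ?; rewrite ler_norml.
by case: (leP d s) => ?; case: (leP d t) => ?; case: (leP (- d) d) => ?;
  case: (leP (- d) s) => ?; case: (leP (- d) t) => ?; apply/andP; split; lra.
Qed.

Lemma shrink_near d t : 0 <= d -> `|shrink d t - t| <= d.
Proof.
move=> d0; rewrite /shrink addrAC subrr sub0r normrN ler_norml.
by case: (leP d t) => ?; case: (leP (- d) d) => ?; case: (leP (- d) t) => ?;
  apply/andP; split; lra.
Qed.

Lemma shrink0 d t : 0 <= d -> `|t| <= d -> shrink d t = 0.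
Proof.
move=> d0; rewrite /shrink ler_norml => /andP[? ?]; rewrite min_r// max_r ?subrr//.
Qed.

Definition tent (d t : R) : R := Num.max 0 (1 - d^-1 * `|t|).

Lemma tent_lip d s t : 0 < d -> `|tent d s - tent d t| <= d^-1 * `|s - t|.
Proof.
move=> d0; have : d^-1 * `| `|s| - `|t| | <= d^-1 * `|s - t|.
  by rewrite ler_wpM2l ?invr_ge0 ?(ltW d0)// ler_dist_dist.
rewrite -[d^-1 in leLHS]ger0_norm ?invr_ge0 ?(ltW d0)// -normrM mulrBr /tent.
set a := d^-1 * `|s|; set b := d^-1 * `|t| => h; apply: le_trans h.
have := ler_norm (a - b); have := ler_norm (b - a); rewrite (distrC b a) => ? ?.
by rewrite ler_norml; case: (leP 0 (1 - a)) => ?; case: (leP 0 (1 - b)) => ?;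
  apply/andP; split; lra.
Qed.

Lemma tent_range d t : 0 < d -> 0 <= tent d t <= 1.
Proof.
move=> d0; rewrite /tent le_max lexx ge_max ler01/= lerBlDl lerDr.
by rewrite mulr_ge0 ?invr_ge0 ?(ltW d0).
Qed.

(** A quantitative form of locality: shrinking [w] to [w'] makes it vanish on a neighbourhood
    [{|w| <= d}] of [{w = 0}]; the part of [f] carried by that neighbourhood does not
    contribute to the value at [w'] by the locality axiom, and the rest is controlled by the mass
    of [{w != 0}].  The shrunk functions converge to [w] with bounded constants. *)
Lemma current_local_bound T mu f pi i w : is_current T -> mass_bound T mu ->
  `|T f (dfwith pi i w)| <= (\prod_(j < m) lip_const (dfwith pi i w j)) *
     \int[mu]_x (`|f x| * \1_[set x : borel X | w x != 0] x).
Proof.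
move=> [mT cT lT _] Tmu; set P := \prod_(_ < _) _; set I0 := (X in _ <= P * X).
have mw := is_lip_measurable (lip_lip w).
have mS : measurable [set x : borel X | w x != 0].
  have -> : [set x : borel X | w x != 0] = ~` (w @^-1` [set 0]).
    by apply/seteqP; split=> x /= /eqP.
  by apply: measurableC; rewrite -[X in measurable X]setTI; exact: mw.
pose d k : R := k.+1%:R^-1; have d0 k : 0 < d k by rewrite invr_gt0.
have wk k : exists v : Lip X, v = (fun x => shrink (d k) (w x)) :> (X -> R).
  apply: lip_exists; apply: (@is_lip_comp _ _ (shrink (d k)) 1) => //.
    by move=> s t; apply: shrink_lip; exact: ltW.
  exact: lip_lip.
pose v k := projT1 (cid (wk k)).
have vE k x : v k x = shrink (d k) (w x) by rewrite /v; case: cid => u /= ->.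
have lv k : lip_const (v k) <= lip_const w.
  have [K0 wK] := lip_constP (lip_lip w).
  apply: lip_const_lb; split=> // x y; rewrite !vE.
  by rewrite (le_trans (shrink_lip _ _ (ltW (d0 k))))// mul1r.
have lpi k j : lip_const (dfwith pi i (v k) j) <= lip_const (dfwith pi i w j).
  by have [->|ij] := eqVneq j i; [rewrite !dfwithin|rewrite !dfwithout// eq_sym].
have bound k : `|T f (dfwith pi i (v k))| <= P * I0.
  have [u uE] : exists u : Lipb X, u = (fun x => tent (d k) (w x)) :> (X -> R).
    apply: lipb_exists.
      apply: (@is_lip_comp _ _ (tent (d k)) (d k)^-1); first by rewrite invr_ge0 ltW.
        by move=> s t; exact: tent_lip.
      exact: lip_lip.
    by exists 1 => x; have /andP[t0 t1] := tent_range (w x) (d0 k); rewrite ger0_norm.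
  rewrite (lipb_mul_split f u) multilinear_addl//.
  have -> : T (lipb_mul f u) (dfwith pi i (v k)) = 0.
    pose B j : set (borel X) := if j == i then [set x | `|w x| <= d k] else set0.
    apply: (lT _ _ B).
    - move=> j; rewrite /B; case: ifP => // _.
      have -> : [set x : borel X | `|w x| <= d k] = w @^-1` `[- d k, d k].
        by apply/seteqP; split=> x; rewrite /= in_itv/= ler_norml.
      by rewrite -[X in measurable X]setTI; exact: mw.
    - move=> j; exists 0 => x; rewrite /B; have [->|//] := eqVneq j i.
      by rewrite dfwithin vE => wx; rewrite shrink0// ltW.
    - move=> x; rewrite /= uE => fu0; exists i => //; rewrite /B eqxx /=.
      rewrite leNgt; apply: contra_neqN fu0 => wx; rewrite /tent max_l ?mulr0//.
      by rewrite subr_le0 mulrC ler_pdivlMr// mul1r ltW.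
  rewrite add0r (le_trans (mass_boundR _ _ Tmu))// ler_pM//.
  - by apply: prodr_ge0 => j _; exact/lip_const_ge0/lip_lip.
  - exact: Rintegral_ge0.
  - by apply: ler_prod => j _; rewrite lpi andbT; exact/lip_const_ge0/lip_lip.
  apply: bmeas_le_Rintegral.
  - by apply: bmeas_norm; exact: lipb_bmeas.
  - by apply: bmeas_lipb_mul; exact: bmeas_indic.
  move=> x; rewrite [lipb_mul f _ x](_ : _ = f x * (1 - u x))//.
  rewrite normrM ler_wpM2l// uE.
  have /andP[t0 t1] := tent_range (w x) (d0 k).
  rewrite ger0_norm ?subr_ge0// indicE.
  have [w0|w0] := eqVneq (w x) 0.
    by rewrite memNset /=; [rewrite w0 /tent normr0 mulr0 subr0 max_r// subrr|rewrite w0 eqxx].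
  by rewrite mem_set//= lerBlDr lerDl.
have cvgT : `|T f (dfwith pi i (v k))| @[k --> \oo] --> `|T f (dfwith pi i w)|.
  apply: cvg_norm; apply: (cT f (fun k => dfwith pi i (v k))).
    move=> j x; have [->|ij] := eqVneq j i; last first.
      have ij' : i != j by rewrite eq_sym.
      by rewrite dfwithout//; under eq_fun do rewrite dfwithout//; exact: cvg_cst.
    rewrite dfwithin; under eq_fun do rewrite dfwithin vE.
    apply/cvgrPdist_le => e e0; near=> k.
    rewrite distrC (le_trans (shrink_near _ (ltW (d0 k))))//.
    by near: k; apply: filterS (near_infty_natSinv_lt (PosNum e0)) => k; exact: ltW.
  exists (\sum_(j < m) lip_const (dfwith pi i w j)) => j k.
  rewrite (le_trans (lpi k j))// (bigD1 j)//= lerDl.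
  by apply: sumr_ge0 => l _; exact/lip_const_ge0/lip_lip.
rewrite -(cvg_lim _ cvgT)//; apply: limr_le; first by apply/cvg_ex; eexists; exact: cvgT.
exact: nearW.
Unshelve. all: by end_near.
Qed.

End locality.

(** * The pointwise Lipschitz constant *)

Section pointwise_lipschitz.
Context {R : realType} {X : completeMetricType R}.
Implicit Types (f : X -> R) (x y : X).

Lemma ptlip_scale_ge f (r s : R) x y : 0 < s < r -> mdist x y < s ->
  ((`|f x - f y| / s)%:E <= ptlip_scale r f x)%E.
Proof.
move=> sr xy; apply: le_ereal_sup_tmp.
exists (ereal_sup [set (`|f x - f y| / s)%:E | y in [set y | mdist x y < s]]).
  by exists s.
by apply: ereal_sup_ubound; exists y.
Qed.

Lemma ptlip_scale_ge0 f (r : R) x : 0 < r -> (0 <= ptlip_scale r f x)%E.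
Proof.
move=> r0; have r20 : 0 < r / 2 by rewrite divr_gt0.
have := @ptlip_scale_ge f r (r / 2) x x; rewrite subrr normr0 mul0r mdistxx; apply=> //.
by rewrite r20 gtr_pMr// invf_lt1// ltr1n.
Qed.

Lemma ptlip_scale_le f (r K : R) x : lip_bound f K -> (ptlip_scale r f x <= K%:E)%E.
Proof.
move=> [K0 fK]; apply: ge_ereal_sup => _ [s /andP[s0 _] <-].
apply: ge_ereal_sup => _ [y /= xy <-]; rewrite lee_fin ler_pdivrMr//.
by rewrite (le_trans (fK x y))// ler_wpM2l// ltW.
Qed.

Lemma ptlip_scale_nd f x : {homo (fun r => ptlip_scale r f x) : r s / r <= s >-> (r <= s)%E}.
Proof.
move=> r s rs; apply: ereal_sup_le => _ [t /andP[t0 tr] <-].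
by exists t => //; rewrite /= t0 (lt_le_trans tr).
Qed.

Lemma ptlipE f x : ptlip f x = ereal_inf [set ptlip_scale r f x | r in `]0, +oo[].
Proof.
apply/cvg_lim => //.
apply: (@nondecreasing_at_right_cvge _ (fun r => ptlip_scale r f x) 0 (BInfty _ false)) => //.
by move=> r s _ _; exact: ptlip_scale_nd.
Qed.

Lemma ptlip_ge0 f x : (0 <= ptlip f x)%E.
Proof.
rewrite ptlipE; apply: le_ereal_inf_tmp => _ [r + <-].
by rewrite /= in_itv/= andbT => r0; exact: ptlip_scale_ge0.
Qed.

Lemma ptlip_le f (K : R) x : lip_bound f K -> (ptlip f x <= K%:E)%E.
Proof.
move=> fK; rewrite ptlipE; apply: ge_ereal_inf; exists (ptlip_scale 1 f x).
  by exists 1 => //=; rewrite in_itv/= ltr01.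
exact: ptlip_scale_le.
Qed.

Lemma ptlip_lt f x (a : \bar R) :
  (ptlip f x < a)%E <-> exists n : nat, (ptlip_scale n.+1%:R^-1 f x < a)%E.
Proof.
rewrite ptlipE; split=> [/ereal_inf_lt[_ [r + <-] ra]|[n na]].
  rewrite /= in_itv/= andbT => r0; exists (Num.Def.trunc r^-1).
  apply: le_lt_trans ra; apply: ptlip_scale_nd.
  by rewrite invf_ple ?posrE// ltW// truncnS_gt.
apply: le_lt_trans na; apply: ge_ereal_inf; exists (ptlip_scale n.+1%:R^-1 f x) => //.
by exists n.+1%:R^-1 => //=; rewrite in_itv/= invr_gt0 ltr0n.
Qed.

Lemma ptlip_scale_dist f (r K : R) x y : 0 <= K -> (ptlip_scale r f x <= K%:E)%E ->
  mdist x y < r -> `|f x - f y| <= K * mdist x y.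
Proof.
move=> K0 fK xyr; apply/ler_addgt0Pr => e e0.
have K1 : 0 < K + 1 by rewrite ltr_wpDl.
pose d := Num.min ((r - mdist x y) / 2) (e / (K + 1)).
have d0 : 0 < d by rewrite lt_min !divr_gt0// subr_gt0.
have m0 := mdist_ge0 x y.
have s0 : 0 < mdist x y + d by rewrite ltr_wpDl.
have dr : d <= (r - mdist x y) / 2 by rewrite ge_min lexx.
have de : d <= e / (K + 1) by rewrite ge_min lexx orbT.
have sr : mdist x y + d < r by lra.
have := @ptlip_scale_ge f r (mdist x y + d) x y.
rewrite s0 ltrDl d0 sr => /(_ isT isT) /le_trans/(_ fK).
rewrite lee_fin ler_pdivrMr// mulrDr => /le_trans; apply; rewrite lerD2l.
move: de; rewrite ler_pdivlMr// => de; apply: le_trans de.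
by rewrite mulrC ler_wpM2l ?(ltW d0)// lerDl.
Qed.

(** On a set where the oscillation of [f] at scale [r] is at most [K] and [f] varies by at most
    [K r], points at distance less than [r] are handled by the first condition and the others by
    the second, so that [f] is [K]-Lipschitz there. *)
Lemma slice_lip f (r K a : R) x y : 0 <= K ->
  (ptlip_scale r f x <= K%:E)%E -> a <= f x <= a + K * r -> a <= f y <= a + K * r ->
  `|f x - f y| <= K * mdist x y.
Proof.
move=> K0 fK /andP[? ?] /andP[? ?]; have [xyr|rxy] := ltP (mdist x y) r.
  exact: ptlip_scale_dist fK xyr.
apply: (@le_trans _ _ (K * r)); last by rewrite ler_wpM2l.
by rewrite ler_norml; apply/andP; split; lra.
Qed.

(** The strict inequalities [mdist x y < s] and [a < |f x - f y| / s] are stable under a small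
    change of [x], so the scale-[r] oscillation is lower semicontinuous. *)
Lemma ptlip_scale_open f (r : R) (a : \bar R) : is_lip f ->
  open [set x | (a < ptlip_scale r f x)%E].
Proof.
move=> /is_lip_continuous fc; rewrite openE => x /= /ereal_sup_gt[_ [s s0r <-]].
move=> /ereal_sup_gt[_ [y /= xy <-]] axy.
have h1 : \forall z \near x, mdist z y < s.
  apply/nbhs_ballP; exists (s - mdist x y) => /=; first by rewrite subr_gt0.
  move=> z; rewrite ballEmdist/= => xz.
  rewrite (le_lt_trans (metric_triangle z x y))// (metric_sym z x); lra.
have h2 : \forall z \near x, (a < (`|f z - f y| / s)%:E)%E.
  case: a axy => [a| |] //=; last by move=> _; apply: nearW => z; rewrite ltNyr.
  rewrite lte_fin => axy.
  have : (`|f z - f y| / s) @[z --> x] --> `|f x - f y| / s.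
    by apply: cvgMl; apply: cvg_norm; apply: cvgB; [exact: fc|exact: cvg_cst].
  by move=> /cvgr_gt/(_ _ axy).
apply: filterS2 h1 h2 => z zy az.
by apply: (lt_le_trans az); apply: ptlip_scale_ge.
Qed.

Lemma ptlip_scale_measurable f (r : R) : is_lip f ->
  measurable_fun [set: borel X] (ptlip_scale r f : borel X -> \bar R).
Proof.
move=> fl; apply: (measurability _ (ErealGenOInfty.measurableE R)) => _ [_ [a ->] <-].
rewrite setTI; apply: open_measurable_borel.
have := ptlip_scale_open r a%:E fl; congr open.
by apply/seteqP; split=> x /=; rewrite in_itv/= andbT.
Qed.

Lemma ptlip_measurable f : is_lip f ->
  measurable_fun [set: borel X] (ptlip f : borel X -> \bar R).
Proof.
move=> fl; apply: (measurability _ (ErealGenInftyO.measurableE R)) => _ [_ [a ->] <-].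
have -> : [set: borel X] `&` ptlip f @^-1` `]-oo, a%:E[ =
    \bigcup_n [set x : borel X | (ptlip_scale n.+1%:R^-1 f x < a%:E)%E].
  apply/seteqP; split=> [x [_ /=]|x [n _ /= h]].
    by rewrite in_itv/= => /ptlip_lt[n h]; exists n.
  by split=> //=; rewrite in_itv/=; apply/ptlip_lt; exists n.
apply: bigcup_measurable => n _.
have := emeasurable_fun_infty_o measurableT (ptlip_scale_measurable n.+1%:R^-1 fl) a%:E.
by rewrite setTI.
Qed.

Definition rptlip f x : R := fine (ptlip f x).

Lemma ptlip_EFin f x : is_lip f -> ptlip f x = (rptlip f x)%:E.
Proof.
move=> /lip_constP fK; rewrite fineK// ge0_fin_numE ?ptlip_ge0//.
by rewrite (le_lt_trans (ptlip_le x fK))// ltry.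
Qed.

Lemma rptlip_ge0 f x : 0 <= rptlip f x.
Proof. by rewrite fine_ge0// ptlip_ge0. Qed.

Lemma rptlip_bmeas f : is_lip f -> bmeas (rptlip f : borel X -> R).
Proof.
move=> fl; split; first exact: measurableT_comp (ptlip_measurable fl).
exists (lip_const f) => x; rewrite ger0_norm ?rptlip_ge0// -lee_fin -ptlip_EFin//.
by apply: ptlip_le; exact: lip_constP.
Qed.

End pointwise_lipschitz.

(** * The pointwise mass bound *)

Section pointwise_mass_bound.
Context {R : realType} {X : completeMetricType R} {m : nat}.
Variables (T : functional X m) (mu : {finite_measure set (borel X) -> \bar R}).
Hypotheses (cT : is_current T) (Tmu : mass_bound T mu).
Implicit Types (pi : 'I_m -> Lip X).

(** The densities [density k pi] interpolate between the bound in the definition of mass, for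
    [k = 0], and the pointwise bound, for [k = m], changing one factor at a time. *)
Definition slope k pi (i : 'I_m) (x : borel X) : R :=
  if (i < k)%N then rptlip (pi i) x else lip_const (pi i).

Definition density k pi (x : borel X) : R := \prod_(i < m) slope k pi i x.

Lemma slope_ge0 k pi i x : 0 <= slope k pi i x.
Proof.
by rewrite /slope; case: ifP => _; [exact: rptlip_ge0|exact/lip_const_ge0/lip_lip].
Qed.

Lemma slope_bmeas k pi i : bmeas (slope k pi i).
Proof.
by rewrite /slope; case: (i < k)%N; [exact: (rptlip_bmeas (lip_lip _))|exact: bmeas_cst].
Qed.

Lemma density0 pi : dominated (T ^~ pi) mu (density 0 pi).
Proof.
split=> [|x|f]; [exact/bmeas_prod/slope_bmeas|by apply: prodr_ge0 => i _; exact: slope_ge0|].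
rewrite (le_trans (mass_boundR f pi Tmu))// -bmeas_RintegralZ; last first.
  by apply: bmeas_norm; exact: lipb_bmeas.
by rewrite le_eqVlt; apply/orP; left; apply/eqP/eq_Rintegral => x _; rewrite mulrC.
Qed.

Section step.
Variables (k : 'I_m) (pi : 'I_m -> Lip X).
Hypothesis IH : forall pi, dominated (T ^~ pi) mu (density k pi).

Let Q pi (x : borel X) : R := \prod_(i < m | i != k) slope k pi i x.

Let Q_ge0 pi' x : 0 <= Q pi' x.
Proof. by apply: prodr_ge0 => i _; exact: slope_ge0. Qed.

Let Q_bmeas pi' : bmeas (Q pi').
Proof.
pose s i := if i != k then slope k pi' i else cst 1.
have bs i : bmeas (s i).
  by rewrite /s; case: ifP => _; [exact: slope_bmeas|exact: bmeas_cst].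
have := bmeas_prod (index_enum 'I_m) bs.
congr bmeas; apply/funext => x; rewrite /Q [RHS]big_mkcond/=.
by apply: eq_bigr => i _; rewrite /s; case: ifP.
Qed.

Let densityE pi' x : density k pi' x = lip_const (pi' k) * Q pi' x.
Proof. by rewrite /density (bigD1 k)//= /slope ltnn. Qed.

Let densityS pi' x : density k.+1 pi' x = rptlip (pi' k) x * Q pi' x.
Proof.
rewrite /density (bigD1 k)//= {1}/slope ltnSn; congr (_ * _).
apply: eq_bigr => i ik; rewrite /slope ltnS leq_eqVlt.
by rewrite (negbTE (_ : (i != k :> nat))).
Qed.

Let Q_dfwith w : Q (dfwith pi k w) = Q pi.
Proof.
apply/funext => x; apply: eq_bigr => i ik.
by rewrite /slope dfwithout// eq_sym.
Qed.

(** On [A], replace [pi k] by a [K]-Lipschitz extension [w] of its restriction to [A]; by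
    locality this costs only an integral over the complement of [A], where the bound provided by
    the induction hypothesis is used instead. *)
Let dominated_on (A : set (borel X)) (K : R) : measurable A -> 0 <= K ->
  (forall x y, A x -> A y -> `|pi k x - pi k y| <= K * mdist x y) ->
  dominated (T ^~ pi) mu (fun x =>
    K * Q pi x * \1_A x + lip_const (pi k) * Q pi x * \1_(~` A) x).
Proof.
move=> mA K0 AK; have [w [wK wA]] := lip_extension K0 AK.
have [mT _ _ _] := cT.
have mA' : measurable (~` A) by exact: measurableC.
have bA : bmeas (\1_A : borel X -> R) by exact: bmeas_indic.
have bA' : bmeas (\1_(~` A) : borel X -> R) by exact: bmeas_indic.
pose C := \prod_(j < m) lip_const (dfwith pi k (pi k - w) j).
have C0 : 0 <= C by apply: prodr_ge0 => j _; exact/lip_const_ge0/lip_lip.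
have lk0 : 0 <= lip_const (pi k) by exact/lip_const_ge0/lip_lip.
have bKQ : bmeas (fun x => K * Q pi x) by apply: bmeasM => //; exact: bmeas_cst.
have bLQ : bmeas (fun x => lip_const (pi k) * Q pi x) by apply: bmeasM => //; exact: bmeas_cst.
have bCA : bmeas (fun x : borel X => C * \1_(~` A) x) by apply: bmeasM => //; exact: bmeas_cst.
have dom : dominated (T ^~ pi) mu (fun x => K * Q pi x + C * \1_(~` A) x).
  split=> [|x|f]; first exact: bmeasD.
    by rewrite addr_ge0 ?mulr_ge0//; case/andP: (indic_le1 (R := R) (~` A) x).
  have -> : T f pi = T f (dfwith pi k (pi k)).
    congr T; apply/funext => j; have [->|jk] := eqVneq j k; first by rewrite dfwithin.
    by rewrite dfwithout// eq_sym.
  rewrite (multilinear_dfwithB f pi k (pi k) w)// (le_trans (ler_normD _ _))//.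
  have -> : \int[mu]_x (`|f x| * (K * Q pi x + C * \1_(~` A) x)) =
      \int[mu]_x (`|f x| * (K * Q pi x)) + \int[mu]_x (`|f x| * (C * \1_(~` A) x)).
    rewrite -bmeas_RintegralD; [|exact: bmeas_lipb_mul..].
    by apply: eq_Rintegral => x _; rewrite mulrDr.
  apply: lerD.
    have [bd _ /(_ f) h] := IH (dfwith pi k w); apply: (le_trans h).
    apply: bmeas_le_Rintegral; [exact: bmeas_lipb_mul..|move=> x].
    by rewrite ler_wpM2l// densityE dfwithin Q_dfwith ler_wpM2r.
  apply: (le_trans (current_local_bound f pi k (pi k - w) cT Tmu)).
  have mS : measurable [set x : borel X | (pi k - w) x != 0].
    have -> : [set x : borel X | (pi k - w) x != 0] = ~` ((pi k - w) @^-1` [set 0]).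
      by apply/seteqP; split=> x /= /eqP.
    apply: measurableC; rewrite -[X in measurable X]setTI.
    exact: (is_lip_measurable (lip_lip (pi k - w))).
  rewrite -bmeas_RintegralZ; last by apply: bmeas_lipb_mul; exact: bmeas_indic.
  apply: bmeas_le_Rintegral; last 1 first.
  - move=> x; rewrite mulrCA ler_wpM2l// ler_wpM2l// !indicE.
    have [xA|xA] := boolP (x \in ~` A); first by case: (_ \in _).
    rewrite memNset//= => /eqP; apply; apply/eqP; rewrite subr_eq0.
    move: xA; rewrite in_setC negbK inE => /wA/= ->//.
  - by apply: bmeasM; [exact: bmeas_cst|apply: bmeas_lipb_mul; exact: bmeas_indic].
  - exact: bmeas_lipb_mul.
have dom' : dominated (T ^~ pi) mu (fun x => lip_const (pi k) * Q pi x).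
  by have := IH pi; congr dominated; apply/funext => x; rewrite densityE.
split=> [|x|f]; first by apply: bmeasD; exact: bmeasM.
  have /andP[? _] := indic_le1 (R := R) A x; have /andP[? _] := indic_le1 (R := R) (~` A) x.
  by rewrite addr_ge0 ?mulr_ge0.
have add u v : T (u + v) pi = T u pi + T v pi by exact: multilinear_addl.
apply: (le_trans (dominated_glue add mA dom dom' f)).
rewrite -bmeas_RintegralD; last 2 first.
- by apply: bmeas_lipb_mul; apply: bmeasM => //; exact: bmeasD.
- by apply: bmeas_lipb_mul; exact: bmeasM.
rewrite le_eqVlt; apply/orP; left; apply/eqP/eq_Rintegral => x _.
rewrite -mulrDr indic_setC; congr (_ * (_ + _)).
by rewrite indicE; case: (_ \in _); rewrite /= ?(mulr0, mulr1, subrr, addr0).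
Qed.

Lemma density_step : dominated (T ^~ pi) mu (density k.+1 pi).
Proof.
have lk := lip_lip (pi k).
pose A (p : nat * rat * int) : set (borel X) :=
  let r := p.1.1.+1%:R^-1 in let K : R := ratr p.1.2 in
  [set x | (ptlip_scale r (pi k) x <= K%:E)%E] `&`
  (pi k @^-1` `[p.2%:~R * (K * r), p.2%:~R * (K * r) + K * r]).
have mA p : measurable (A p).
  apply: measurableI.
    have := emeasurable_fun_infty_c measurableT
      (ptlip_scale_measurable p.1.1.+1%:R^-1 lk) (ratr p.1.2)%:E.
    by rewrite setTI.
  by rewrite -[X in measurable X]setTI; exact: (is_lip_measurable lk).
pose theta_ n : borel X -> R := match (unpickle n : option (nat * rat * int)) with
  | Some p => if 0 < p.1.2 then fun x => ratr p.1.2 * Q pi x * \1_(A p) x +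
      lip_const (pi k) * Q pi x * \1_(~` A p) x else density k pi
  | None => density k pi end.
have [mT _ _ _] := cT.
have add f g : T (f + g) pi = T f pi + T g pi by exact: multilinear_addl.
apply: (dominated_inf add (theta_ := theta_)).
- move=> n; rewrite /theta_; case: unpickle => [p|]; last exact: IH.
  case: ifP => [p0|_]; last exact: IH.
  have K0 : 0 <= ratr p.1.2 :> R by rewrite ler0q ltW.
  apply: dominated_on => // x y [/= xr +] [_ /= +]; rewrite !in_itv/= => fx fy.
  exact: slice_lip xr fx fy.
- exact/bmeas_prod/slope_bmeas.
- by move=> x; apply: prodr_ge0 => i _; exact: slope_ge0.
move=> x e e0; have Q1 : 0 < Q pi x + 1 by rewrite ltr_wpDl.
(* [q] is a rational slightly above the pointwise constant, [1/(n+1)] a scale at which the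
   oscillation at [x] is below [q], and [z] the index of the slice containing [pi k x]. *)
have : rptlip (pi k) x < rptlip (pi k) x + e / (Q pi x + 1) by rewrite ltrDl divr_gt0.
move=> /rat_in_itvoo[q]; rewrite in_itv/= => /andP[pq qe].
have q0 : 0 < ratr q :> R by apply: le_lt_trans pq; exact: rptlip_ge0.
have [n nq] : exists n : nat, (ptlip_scale n.+1%:R^-1 (pi k) x < (ratr q)%:E)%E.
  by apply/ptlip_lt; rewrite ptlip_EFin// lte_fin.
pose w : R := ratr q * n.+1%:R^-1.
have w0 : 0 < w by rewrite mulr_gt0// invr_gt0.
pose z : int := Num.floor (pi k x / w).
exists (pickle (n, q, z)); rewrite /theta_ pickleK/= -(ltr0q R) q0.
rewrite densityS indic_setC; have -> : (\1_(A (n, q, z)) x : R) = 1.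
  rewrite indicE mem_set//; split; first exact: ltW.
  rewrite /= in_itv/= -/w -ler_pdivlMr// floor_le_tmp/=.
  rewrite -[X in _ + X]mul1r -mulrDl -ler_pdivrMr// ltW//.
  by rewrite -[1]/(1%:~R) -intrD floorD1_gt.
rewrite subrr mulr0 addr0 mulr1.
apply: (@le_trans _ _ ((rptlip (pi k) x + e / (Q pi x + 1)) * Q pi x)).
  by rewrite ler_wpM2r// ltW.
rewrite mulrDl lerD2l mulrAC ler_pdivrMr// ler_wpM2l ?(ltW e0)//.
by rewrite lerDl.
Qed.

End step.

Lemma density_dominated k pi : dominated (T ^~ pi) mu (density k pi).
Proof.
elim: k pi => [|k IHk] pi; first exact: density0.
have [km|mk] := ltnP k m; first exact: (density_step (k := Ordinal km)).
have := IHk pi; congr dominated; apply/funext => x; apply: eq_bigr => i _.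
by rewrite /slope !(leq_trans (ltn_ord i))// (leq_trans mk).
Qed.

Theorem pointwise_mass_bound (f : Lipb X) pi :
  `|T f pi| <= \int[mu]_x (`|f x| * \prod_(i < m) rptlip (pi i) x).
Proof.
have [_ _ /(_ f)] := density_dominated m pi; congr (_ <= _).
apply: eq_Rintegral => x _; congr (_ * _); apply: eq_bigr => i _.
by rewrite /slope ltn_ord.
Qed.

End pointwise_mass_bound.

(** * Existence of the mass measure *)

Section decreasing_limit.
Context d (T : measurableType d) (R : realType).
Variable nu_ : nat -> {finite_measure set T -> \bar R}.
Hypothesis nd : forall n A, measurable A -> (nu_ n.+1 A <= nu_ n A)%E.
Local Open Scope ereal_scope.

(** The hypothesis is an argument so that the instances below can be inferred. *)
Definition decreasing_limit
    & (forall n A, measurable A -> nu_ n.+1 A <= nu_ n A) :=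
  fun A : set T => ereal_inf (range (fun n => nu_ n A)).
Local Notation nu := (decreasing_limit nd).

Let nonincr A : measurable A -> nonincreasing_seq (fun n => nu_ n A).
Proof.
move=> mA; apply/nonincreasing_seqP => n.
exact: nd.
Qed.

Let limit_cvg A : measurable A -> nu_ n A @[n --> \oo] --> nu A.
Proof. by move=> mA; exact: ereal_nonincreasing_cvgn (nonincr mA). Qed.

Let limit_le A n : nu A <= nu_ n A.
Proof. by apply: ereal_inf_lbound; exists n. Qed.

Let limit_ge0 A : 0 <= nu A.
Proof. by apply: le_ereal_inf_tmp => _ [n _ <-]. Qed.

Let limit0 : nu set0 = 0.
Proof. by apply/eqP; rewrite eq_le limit_ge0 andbT -(measure0 (nu_ 0%N)) limit_le. Qed.

Let limit_fin A : measurable A -> nu A \is a fin_num.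
Proof.
move=> mA; rewrite ge0_fin_numE//; apply: le_lt_trans (limit_le A 0%N) _.
by rewrite -ge0_fin_numE// fin_num_measure.
Qed.

Let limitU A B : measurable A -> measurable B -> A `&` B = set0 ->
  nu (A `|` B) = nu A + nu B.
Proof.
move=> mA mB AB; have mAB := measurableU _ _ mA mB.
rewrite -(cvg_lim _ (limit_cvg mAB))//; apply/cvg_lim => //.
rewrite (_ : (fun n => nu_ n (A `|` B)) = (fun n => nu_ n A + nu_ n B)); last first.
  by apply/funext => n; rewrite measureU.
apply: cvgeD; [|exact: limit_cvg|exact: limit_cvg].
by apply: fin_num_adde_defr; exact: limit_fin.
Qed.

(** Countable additivity is inherited from [nu_ 0], which dominates the tails. *)
Let limit_sigma_additive : semi_sigma_additive nu.
Proof.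
move=> F mF tF mU; set U := \bigcup_n F n.
pose B n := \big[setU/set0]_(0 <= i < n) F i.
have mB n : measurable (B n) by rewrite /B big_mkord; exact: bigsetU_measurable.
have mUB n : measurable (U `\` B n) by exact: measurableD.
have BE n : B n = \bigcup_(i < n) F i by rewrite /B big_mkord -bigcup_mkord.
have sumB n : \sum_(0 <= i < n) nu (F i) = nu (B n).
  elim: n => [|n IHn]; first by rewrite /B !big_geq.
  have BF : B n `&` F n = set0.
    apply/seteqP; split=> // x [+ Fx]; rewrite BE => -[i /= lin Fi].
    have /trivIsetP/(_ i n I I) := tF; rewrite ltn_eqF// => /(_ isT).
    by move=> /seteqP[/(_ x) + _]; apply; split.
  rewrite big_nat_recr//= IHn (_ : B n.+1 = B n `|` F n) ?limitU//.
  by rewrite /B big_nat_recr.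
have UE n : nu (B n) = nu U - nu (U `\` B n).
  have BU : B n `<=` U by rewrite BE => x [i _ Fi]; exists i.
  rewrite -[in nu U](setDUK BU) limitU ?addeK ?limit_fin//.
  by rewrite setDE setICA setICr setI0.
rewrite (_ : (fun n => _) = (fun n => nu U - nu (U `\` B n))); last first.
  by apply/funext => n; rewrite sumB UE.
rewrite -[X in _ --> X]sube0; apply: cvgeB.
- by apply: fin_num_adde_defr; exact: limit_fin.
- exact: cvg_cst.
apply: (@squeeze_cvge _ _ _ _ (cst 0) _ (fun n => nu_ 0%N (U `\` B n))).
- by apply: nearW => n; rewrite limit_ge0 limit_le.
- exact: cvg_cst.
have I0 : \bigcap_n (U `\` B n) = set0.
  apply/seteqP; split=> // x h; have [[k _ Fk] _] := h 0%N I.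
  by have [_] := h k.+1 I; rewrite BE; apply; exists k => /=.
have := @nonincreasing_cvg_mu _ _ _ (nu_ 0%N) (fun n => U `\` B n).
rewrite I0 measure0; apply => //.
- by rewrite -ge0_fin_numE// fin_num_measure.
- move=> i j ij; apply/subsetPset => x [Ux Bx]; split=> //.
  by apply: contra_not Bx; rewrite !BE => -[l /= li Fl]; exists l => //=; exact: leq_trans ij.
Qed.

HB.instance Definition _ := isMeasure.Build _ _ _ nu
  limit0 limit_ge0 limit_sigma_additive.

HB.instance Definition _ := Measure_isFinite.Build _ _ _ nu limit_fin.

Lemma decreasing_limitP : exists rho : {finite_measure set T -> \bar R},
  forall A, measurable A ->
    (forall n, rho A <= nu_ n A) /\
    (forall e : R, (0 < e)%R -> exists n, nu_ n A <= rho A + e%:E).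
Proof.
exists nu => A mA; split=> [n|e e0]; first exact: limit_le.
have : nu A < nu A + e%:E by rewrite lteDl ?limit_fin// lte_fin.
by move=> /ereal_inf_lt[_ [n _ <-] /ltW h]; exists n.
Qed.

End decreasing_limit.

Section mass_existence.
Context {R : realType} {X : completeMetricType R} {m : nat}.
Variable T : functional X m.
Hypothesis mT : multilinear T.
Implicit Types (mu nu rho kappa : {finite_measure set (borel X) -> \bar R}).

Lemma finite_measure_sum_Rintegral mu nu rho (g : borel X -> R) :
  (forall A, rho A = (mu A + nu A)%E) -> bmeas g -> (forall x, 0 <= g x) ->
  \int[rho]_x g x = \int[mu]_x g x + \int[nu]_x g x.
Proof.
move=> rhoE bg g0; apply: EFin_inj; rewrite EFinD !bmeas_EFin_Rintegral//.
rewrite -ge0_integral_measure_add//; last 2 first.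
- by move=> x _; rewrite lee_fin.
- by apply/measurable_EFinP; case: bg.
apply: eq_measure_integral => A mA _.
exact: etrans (rhoE A) (esym (measure_addE mu nu A)).
Qed.

Lemma le_Rintegral_mrestr mu (A : set (borel X)) (mA : measurable A) (g : borel X -> R) :
  bmeas g -> (forall x, 0 <= g x) ->
  \int[mu]_x (g x * \1_A x) <= \int[mrestr mu mA]_x g x.
Proof.
move=> bg g0; have mg : measurable_fun setT (EFin \o g) by apply/measurable_EFinP; case: bg.
rewrite -lee_fin !bmeas_EFin_Rintegral//; last by apply: bmeasM => //; exact: bmeas_indic.
have -> : (\int[mu]_x (g x * \1_A x)%:E = \int[mu]_(x in A) (g x)%:E)%E.
  rewrite [RHS]integral_mkcond; apply: eq_integral => x _.
  by rewrite patchE indicE; case: ifP => _; rewrite ?mulr1 ?mulr0.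
rewrite (eq_measure_integral (mrestr mu mA)); last first.
  by move=> B mB BA; rewrite /= /mrestr setIidl.
by apply: ge0_subset_integral => // x _; rewrite lee_fin.
Qed.

(** The minimum of two measures is obtained from a Hahn decomposition of their difference. *)
Lemma mass_bound_min mu nu : mass_bound T mu -> mass_bound T nu ->
  exists rho, mass_bound T rho /\
    forall A, measurable A -> (rho A <= mu A)%E /\ (rho A <= nu A)%E.
Proof.
move=> Tmu Tnu.
pose sigma := cadd (charge_of_finite_measure mu) (copp (charge_of_finite_measure nu)).
have [P [N [[mP posP] [mN negN] PN PN0]]] := Hahn_decomposition sigma.
have mN' : measurable (~` N) by exact: measurableC.
have N'P : ~` N `<=` P by move=> x; have : [set: borel X] x by []; rewrite -PN => -[].
have [rho rhoE] := finite_measure_sum (mrestr mu mN) (mrestr nu mN').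
exists rho; split.
  move=> f pi; set c := \prod_(i < m) _.
  have c0 : 0 <= c by apply: prodr_ge0 => i _; exact/lip_const_ge0/lip_lip.
  have bf : bmeas (fun x : borel X => `|f x|) by apply: bmeas_norm; exact: lipb_bmeas.
  have dom kappa : mass_bound T kappa -> dominated (T ^~ pi) kappa (fun=> c).
    move=> Tk; split=> // [|g]; first exact: bmeas_cst.
    rewrite (le_trans (mass_boundR g pi Tk))// -bmeas_RintegralZ; last first.
      by apply: bmeas_norm; exact: lipb_bmeas.
    by rewrite le_eqVlt; apply/orP; left; apply/eqP/eq_Rintegral => x _; rewrite mulrC.
  have add u v : T (u + v) pi = T u pi + T v pi by exact: multilinear_addl.
  have bfi (A : set (borel X)) : measurable A -> bmeas (fun x : borel X => `|f x| * \1_A x).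
    by move=> mA; apply: bmeasM => //; exact: bmeas_indic.
  have cE kappa (A : set (borel X)) : measurable A ->
      \int[kappa]_x (`|f x| * (c * \1_A x)) = c * \int[kappa]_x (`|f x| * \1_A x).
    move=> mA; rewrite -bmeas_RintegralZ; last exact: bfi.
    by apply: eq_Rintegral => x _; rewrite mulrCA.
  rewrite -bmeas_EFin_Rintegral// -EFinM lee_fin.
  apply: (le_trans (dominated_glue add mN (dom _ Tmu) (dom _ Tnu) f)).
  rewrite !cE// -mulrDr ler_wpM2l// (finite_measure_sum_Rintegral rhoE)//.
  by apply: lerD; exact: le_Rintegral_mrestr.
move=> A mA; rewrite rhoE /= /mrestr.
have mAN : measurable (A `&` N) by exact: measurableI.
have mAN' : measurable (A `&` ~` N) by exact: measurableI.
have split_ kappa : (kappa A = kappa (A `&` N) + kappa (A `&` ~` N))%E.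
  rewrite -[in LHS](setIT A) -(setUv N) setIUr measureU//.
  by rewrite setIACA setICr setI0.
have muN : (mu (A `&` N) <= nu (A `&` N))%E.
  have := negN _ mAN (@subIsetr _ _ _).
  by rewrite /sigma /cadd /copp /= sube_le0.
have nuN' : (nu (A `&` ~` N) <= mu (A `&` ~` N))%E.
  have := posP _ mAN' (subset_trans (@subIsetr _ _ _) N'P).
  by rewrite /sigma /cadd /copp /= sube_ge0// fin_num_measure.
by split; rewrite [leRHS]split_ leeD.
Qed.

(** For [|f| <= M], passing from [nu_ n] to the limit lowers the integral of [|f|] by at most [M]
    times the loss of total mass. *)
Lemma mass_bound_limit (nu_ : nat -> {finite_measure set (borel X) -> \bar R}) rho :
  (forall n, mass_bound T (nu_ n)) ->
  (forall A, measurable A -> (forall n, (rho A <= nu_ n A)%E) /\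
    (forall e : R, (0 < e)%R -> exists n, (nu_ n A <= rho A + e%:E)%E)) ->
  mass_bound T rho.
Proof.
move=> Tnu rhoP f pi; rewrite -bmeas_EFin_Rintegral; last first.
  by apply: bmeas_norm; exact: lipb_bmeas.
rewrite -EFinM lee_fin; set c := \prod_(i < m) _.
have c0 : 0 <= c by apply: prodr_ge0 => i _; exact/lip_const_ge0/lip_lip.
have bf : bmeas (fun x : borel X => `|f x|) by apply: bmeas_norm; exact: lipb_bmeas.
have [M M0 fM] := lipb_bounded f.
apply/ler_addgt0Pr => e e0; pose K := c * M + 1.
have K0 : 0 < K by rewrite ltr_wpDl// mulr_ge0.
have [_ /(_ _ (divr_gt0 e0 K0))[n]] := rhoP _ (@measurableT _ (borel X)).
rewrite -[nu_ n _]fineK ?fin_num_measure// -[rho _]fineK ?fin_num_measure//.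
rewrite -EFinD lee_fin -!Rintegral_cst1 => rhon.
apply: (le_trans (mass_boundR f pi (Tnu n))); rewrite -/c.
(* Integrating [M - |f|] instead of [|f|] turns the inequality [rho <= nu_ n] into an upper
   bound for the integral with respect to [nu_ n]. *)
have bM : bmeas (fun x : borel X => M - `|f x|) by apply: bmeasB => //; exact: bmeas_cst.
have ME kappa : \int[kappa]_x `|f x| =
    M * \int[kappa]_x (1 : R) - \int[kappa]_x (M - `|f x|).
  rewrite -bmeas_RintegralZ; last exact: bmeas_cst.
  rewrite -bmeas_RintegralB//; last by apply: bmeasM; exact: bmeas_cst.
  by apply: eq_Rintegral => x _; rewrite mulr1 subKr.
have le_int : \int[rho]_x (M - `|f x|) <= \int[nu_ n]_x (M - `|f x|).
  apply: bmeas_Rintegral_mono => // [x|A mA]; first by rewrite subr_ge0.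
  by case: (rhoP A mA).
apply: (@le_trans _ _ (c * (\int[rho]_x `|f x| + M * (e / K)))).
  rewrite ler_wpM2l//; rewrite (ME (nu_ n)) (ME rho).
  have := ler_wpM2l M0 rhon; rewrite mulrDr; lra.
rewrite mulrDr lerD2l !mulrA ler_pdivrMr// [leRHS]mulrC ler_pM2r//.
by rewrite /K lerDl.
Qed.

(** Take minima along a sequence of bounding measures whose total masses tend to the infimum.
    The limit has least total mass; as its minimum with another bounding measure cannot have
    smaller total mass, the limit is below the latter on every set. *)
Lemma mass_exists : (exists mu, mass_bound T mu) -> exists mu, is_mass T mu.
Proof.
move=> [mu0 Tmu0].
pose S := [set fine (mu setT) | mu in [set mu | mass_bound T mu]].
have hS : has_inf S.
  split; first by exists (fine (mu0 setT)); exists mu0.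
  by exists 0 => _ [mu _ <-]; exact: fine_ge0.
have approx n : exists mu, mass_bound T mu /\ fine (mu setT) < inf S + n.+1%:R^-1.
  have n0 : 0 < n.+1%:R^-1 :> R by rewrite invr_gt0.
  by have [_ [mu Tmu <-] h] := inf_adherent n0 hS; exists mu.
pose bm := {mu : {finite_measure set (borel X) -> \bar R} | mass_bound T mu}.
pose a_ n := projT1 (cid (approx n)).
have aT n : mass_bound T (a_ n) by rewrite /a_; case: cid => mu /= [].
have aS n : fine (a_ n setT) < inf S + n.+1%:R^-1 by rewrite /a_; case: cid => mu /= [].
have minP (p q : bm) : exists r : bm, forall A, measurable A ->
    (sval r A <= sval p A)%E /\ (sval r A <= sval q A)%E.
  have [rho [Trho rhoP]] := mass_bound_min (svalP p) (svalP q).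
  by exists (exist _ rho Trho).
pose mn p q := projT1 (cid (minP p q)).
have mnP p q A : measurable A -> (sval (mn p q) A <= sval p A)%E /\
    (sval (mn p q) A <= sval q A)%E by rewrite /mn; case: cid => r rP mA; exact: rP.
pose nu_ := fix nu_ n : bm := if n is k.+1 then mn (nu_ k) (exist _ (a_ n) (aT n))
                              else exist _ (a_ 0%N) (aT 0%N).
have nu_a n A : measurable A -> (sval (nu_ n) A <= a_ n A)%E.
  by case: n => [|n] mA //; exact: (mnP _ _ _ mA).2.
have nd n A : measurable A -> (sval (nu_ n.+1) A <= sval (nu_ n) A)%E.
  by move=> mA; exact: (mnP _ _ _ mA).1.
have [rho rhoP] := decreasing_limitP nd.
have Trho : mass_bound T rho.
  by apply: mass_bound_limit rhoP => n; exact: svalP.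
exists rho; split=> // nu Tnu A mA.
have [kappa [Tkappa kP]] := mass_bound_min Trho Tnu.
have rhoS : fine (rho setT) <= inf S.
  apply/ler_addgt0Pr => e e0.
  have [n _ /(_ n (leqnn n)) ne] := near_infty_natSinv_lt (PosNum e0).
  apply: (@le_trans _ _ (inf S + n.+1%:R^-1)); last by rewrite lerD2l ltW.
  apply: (le_trans _ (ltW (aS n))); apply: fine_le; rewrite ?fin_num_measure//.
  by apply: le_trans (nu_a n _ measurableT); case: (rhoP _ (@measurableT _ (borel X))).
have kappaS : inf S <= fine (kappa setT).
  by apply: ge_inf; [case: hS|exists kappa].
apply: (@le_trans _ _ (kappa A)); last by case: (kP A mA).
have mA' : measurable (~` A) by exact: measurableC.
have splitA (mu : {finite_measure set (borel X) -> \bar R}) :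
    fine (mu setT) = fine (mu A) + fine (mu (~` A)).
  by rewrite -fineD ?fin_num_measure// -measureU ?setUv// setICr.
have : fine (kappa (~` A)) <= fine (rho (~` A)).
  by apply: fine_le; rewrite ?fin_num_measure//; case: (kP _ mA').
rewrite -[rho A]fineK ?fin_num_measure// -[kappa A]fineK ?fin_num_measure// lee_fin.
have := le_trans rhoS kappaS; rewrite !splitA; lra.
Qed.

End mass_existence.

(** The default value in the definition of [mass] is never reached. *)
Lemma mass_bound_mass (R : realType) (X : completeMetricType R) (m : nat)
  (T : current X m) : mass_bound T (mass T).
Proof.
have /asboolP[mT _ _ ex] := current_funP T.
rewrite /mass; case: pselect => [e|/(_ (mass_exists mT ex))//].
by case: cid => mu [].
Qed.

(** * Evaluation cochains *)

Section evaluation_cochain.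
Context {R : realType} {X : completeMetricType R}.

Lemma prod_ptlip n (pi : 'I_n -> Lip X) x :
  (\prod_(i < n) ptlip (pi i) x)%E = (\prod_(i < n) rptlip (pi i) x)%:E.
Proof.
elim: n pi => [|n IHn] pi; first by rewrite !big_ord0.
by rewrite !big_ord_recl EFinM IHn ptlip_EFin//; exact: lip_lip.
Qed.

Lemma evaluation_le n (T : current X n) (f : Lipb X) (pi : 'I_n -> Lip X) :
  (`|(T f pi)%:E| <=
   \int[mass T]_x (`|f x|%:E * \prod_(i < n) ptlip (pi i) x))%E.
Proof.
have /asboolP cT := current_funP T.
rewrite (eq_integral (fun x : borel X => (`|f x| * \prod_(i < n) rptlip (pi i) x)%:E)); last first.
  by move=> x _; rewrite prod_ptlip EFinM.
rewrite -bmeas_EFin_Rintegral; last first.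
  by apply: bmeas_lipb_mul; apply: bmeas_prod => i; exact: (rptlip_bmeas (lip_lip _)).
by rewrite lee_fin; exact: (pointwise_mass_bound cT (mass_bound_mass T)).
Qed.

Lemma measurable_mul_prod_ptlip n (g : X -> R) (pi : 'I_n -> Lip X) :
  bmeas (g : borel X -> R) ->
  measurable_fun [set: borel X]
    ((fun x => (g x)%:E * \prod_(i < n) ptlip (pi i) x)%E : borel X -> \bar R).
Proof.
move=> bg; have [/measurable_EFinP + _] :
    bmeas (fun x : borel X => g x * \prod_(i < n) rptlip (pi i) x).
  by apply: bmeasM => //; apply: bmeas_prod => i; exact: (rptlip_bmeas (lip_lip _)).
by congr measurable_fun; apply/funext => x; rewrite prod_ptlip.
Qed.

Lemma mul_prod_ptlip_ge0 n (g : X -> R) (pi : 'I_n -> Lip X) x : 0 <= g x ->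
  (0 <= (g x)%:E * \prod_(i < n) ptlip (pi i) x)%E.
Proof.
by move=> g0; rewrite prod_ptlip -EFinM lee_fin mulr_ge0// prodr_ge0// => i _; exact: rptlip_ge0.
Qed.

End evaluation_cochain.

Local Open Scope ereal_scope.

Theorem proposition3p8 (R : realType) (X : completeMetricType R) (m : nat)
    (f : Lipb X) (pi : 'I_m -> Lip X) :
  let omega := fun T : current X m => (T f pi)%:E in
  let h := fun x : X => `|f x|%:E * \prod_(i < m) ptlip (pi i) x in
  let g := fun x : X => ptlip f x * \prod_(i < m) ptlip (pi i) x in
  [/\ cochain [set: current X m] omega,
      upper_norm [set: current X m] omega h
    & upper_gradient [set: current X m] [set: current X m.+1] omega g].
Proof.
move=> omega h g; split.
- split=> // T S _ _; rewrite /omega !abse_EFin -EFinD lee_fin.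
  have -> : T f pi = ((T + S)%R f pi - S f pi)%R.
    by rewrite [in RHS](_ : (T + S)%R f pi = (T f pi + S f pi)%R)// addrK.
  exact: ler_normB.
- split=> [|x|T _]; last exact: evaluation_le.
    by apply: measurable_mul_prod_ptlip; apply: bmeas_norm; exact: lipb_bmeas.
  exact: (@mul_prod_ptlip_ge0 _ _ _ (fun x => `|f x|%R) pi x (normr_ge0 _)).
have fl := lipb_lip f.
have gE : g = fun x => (rptlip f x)%:E * \prod_(i < m) ptlip (pi i) x.
  by apply/funext => x; rewrite /g ptlip_EFin.
split=> [|x|T S _ _ ST].
- by rewrite gE; apply: measurable_mul_prod_ptlip; exact: rptlip_bmeas.
- by rewrite gE; apply: mul_prod_ptlip_ge0; exact: rptlip_ge0.
rewrite /omega -ST /boundary; apply: le_trans (evaluation_le _ _ _) _.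
rewrite le_eqVlt; apply/orP; left; apply/eqP/eq_integral => x _.
rewrite normr1 mul1e big_ord_recl unlift_none; congr (_ * _).
by apply: eq_bigr => i _; rewrite liftK.
Qed.
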